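(* Let $\mathbb{K}$ be a field of characteristic zero and let $p\geq 2$ be an integer. The Brauerian functor $B:1Cob\to Mat_{\mathbb{K}}$ with parameter $p$ is faithful; i.e. for all morphisms $K,L:(n,\varepsilon_0)\to(m,\varepsilon_1)$ of $1Cob$, $B(K)=B(L)$ implies $K=L$ in $1Cob$.
   Context: **The category $1Cob$.** Objects are closed oriented $0$-manifolds presented as pairs $(n,\varepsilon)$, where $n=\{0,\ldots,n-1\}$ is a natural number and $\varepsilon:n\to\{-1,1\}$. A $1$-cobordism from $(n,\varepsilon_0)$ to $(m,\varepsilon_1)$ is a triple $(M,f_0:(n,\varepsilon_0)\to M,f_1:(m,\varepsilon_1)\to M)$, where $M$ is a compact oriented $1$-dimensional manifold whose boundary is a disjoint union $\partial M=\Sigma_0\sqcup\Sigma_1$, $f_0$ is an orientation preserving embedding with image $\Sigma_0$ (ingoing boundary), and $f_1$ is an orientation reversing embedding with image $\Sigma_1$ (outgoing boundary). The boundary convention is that the initial point of an oriented interval has sign $+$ and its terminal point has sign $-$ as points of $\partial M$; thus $[0,1]$ with its standard orientation gives cobordisms $+\to+$ (with $0$ ingoing), $-\to-$ (with $1$ ingoing), $+-\to\emptyset$ and $\emptyset\to-+$, where an object is written as a word of signs. Cobordisms $(M,f_0,f_1)$ and $(M',f_0',f_1')$ are equivalent if there is an orientation preserving homeomorphism $\Phi:M\to M'$ with $\Phi f_0=f_0'$ and $\Phi f_1=f_1'$. Morphisms of $1Cob$ are equivalence classes of $1$-cobordisms; composition is gluing along the common boundary; identities are cylinders. **The category $Mat_{\mathbb{K}}$.**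 Objects are natural numbers; morphisms $n\to m$ are the $m\times n$ matrices over $\mathbb{K}$; composition is matrix multiplication. **The Brauerian functor $B$ with parameter $p\ge2$.** For a cobordism $K:(n,\varepsilon_0)\to(m,\varepsilon_1)$ with underlying manifold $M$, label the ingoing boundary points $(0,0),\ldots,(n-1,0)$ and the outgoing ones $(0,1),\ldots,(m-1,1)$, and let $R_K$ be the equivalence relation on $(n\times\{0\})\cup(m\times\{1\})$ relating two points iff they lie in the same connected component of $M$. Let $A(K)$ be the $p^m\times p^n$ matrix whose rows are indexed by the functions $f_i:m\to\{0,\ldots,p-1\}$ and columns by the functions $g_j:n\to\{0,\ldots,p-1\}$ (both viewed as sequences, ordered lexicographically), with $A(K)[i,j]=1$ if the combined function $[g_j,f_i]$, given by $(u,0)\mapsto g_j(u)$, $(v,1)\mapsto f_i(v)$, is constant on each equivalence class of $R_K$, and $A(K)[i,j]=0$ otherwise. Then $B(n,\varepsilon)=p^n$ on objects and $B(K)=p^{a}\cdot A(K)$ on morphisms, where $a$ is the number of connected components of $K$ homeomorphic to the circle $S^1$. $B$ is a functor $1Cob\to Mat_{\mathbb{K}}$. *)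

(* Defs.v *)
From HB Require Import structures.
From mathcomp Require Import all_boot all_order all_algebra finmap.
From mathcomp Require Import all_classical all_reals all_analysis.

Set Implicit Arguments.
Unset Strict Implicit.
Unset Printing Implicit Defensive.

Import Order.TTheory GRing.Theory Num.Theory.
Import numFieldNormedType.Exports.

Local Open Scope classical_set_scope.
Local Open Scope ring_scope.

(* f and g are total functions, but only their restrictions to A and B matter. *)
Definition inverse_homeos (T U : topologicalType) (A : set T) (B : set U)
    (f : T -> U) (g : U -> T) : Prop :=
  [/\ (forall x, A x -> B (f x) /\ g (f x) = x),
      (forall y, B y -> A (g y) /\ f (g y) = y),
      {within A, continuous f} & {within B, continuous g}].

Definition homeomorphic (T U : topologicalType) (A : set T) (B : set U) : Prop :=
  exists f g, inverse_homeos A B f g.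

Definition circle (R : realType) : set (R * R)%type :=
  [set z | z.1 ^+ 2 + z.2 ^+ 2 = 1].
Arguments circle R : clear implicits.

Inductive sign := plus | minus.

Definition opp_sign (s : sign) : sign :=
  match s with plus => minus | minus => plus end.

(* A 1-manifold with boundary is locally modelled on a closed half-line.  In
   dimension 1 an oriented atlas needs both half-lines: the initial point of an
   oriented interval looks like 0 in [0, +oo[, the terminal point like 0 in
   ]-oo, 0].  Accordingly the first model carries the sign + of its end point
   and the second the sign -. *)
Definition half_line (R : realType) (s : sign) : set R :=
  match s with plus => [set t | 0 <= t] | minus => [set t | t <= 0] end.

(* A homeomorphism from an open subset of M onto a relatively open subset of
   a closed half-line. *)
Record chart (R : realType) (M : topologicalType) := Chart {
  chart_side : sign;
  chart_dom : set M;
  chart_cod : set R;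
  chart_fun :> M -> R;
  chart_inv : R -> M;
  chart_dom_open : open chart_dom;
  chart_cod_open : exists2 O : set R,
    open O & chart_cod = O `&` half_line chart_side;
  chart_homeo : inverse_homeos chart_dom chart_cod chart_fun chart_inv }.

(* The local expression of f near x in the charts c and d is increasing.  This
   is only asked locally: on an overlap of charts which is not connected (e.g.
   of two arcs covering a circle) an orientation preserving change of charts
   need not be globally monotone. *)
Definition increasing_at (R : realType) (M N : topologicalType)
    (c : chart R M) (d : chart R N) (f : M -> N) (x : M) : Prop :=
  exists2 W : set M, nbhs x W &
    forall y z, W y -> W z -> (c y < c z) = (d (f y) < d (f z)).

Record oriented_manifold (R : realType) := OrientedManifold {
  carrier :> topologicalType;
  carrier_hausdorff : hausdorff_space carrier;
  carrier_second_countable : @second_countable carrier;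
  carrier_compact : compact [set: carrier];
  atlas : set (chart R carrier);
  atlas_cover : forall x : carrier, exists2 c, atlas c & chart_dom c x;
  atlas_oriented : forall c d, atlas c -> atlas d ->
    forall x, chart_dom c x -> chart_dom d x -> increasing_at c d id x }.

Arguments atlas {R} _.

Definition boundary_point (R : realType) (M : oriented_manifold R)
    (s : sign) (x : M) : Prop :=
  exists c, [/\ atlas M c, chart_side c = s, chart_dom c x & c x = 0].

Definition boundary (R : realType) (M : oriented_manifold R) : set M :=
  [set x | exists s, boundary_point s x].
Arguments boundary {R} _.

Definition orientation_preserving (R : realType) (M N : oriented_manifold R)
    (f : M -> N) : Prop :=
  forall c d, atlas M c -> atlas N d ->
    forall x, chart_dom c x -> chart_dom d (f x) -> increasing_at c d f x.

Record ob1Cob := Ob1Cob {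
  ob_size : nat;
  ob_sign : 'I_ob_size -> sign }.

(* An injection of a finite discrete space in a Hausdorff space is an
   embedding.  It preserves (reverses) orientation when it preserves (reverses)
   signs, the points of the boundary being signed by [boundary_point]. *)
Record cobordism (R : realType) (X Y : ob1Cob) := Cobordism {
  cob_manifold :> oriented_manifold R;
  cob_in : 'I_(ob_size X) -> cob_manifold;
  cob_out : 'I_(ob_size Y) -> cob_manifold;
  cob_in_inj : injective cob_in;
  cob_out_inj : injective cob_out;
  cob_in_sign : forall i, boundary_point (ob_sign i) (cob_in i);
  cob_out_sign : forall j, boundary_point (opp_sign (ob_sign j)) (cob_out j);
  cob_disjoint : range cob_in `&` range cob_out = set0;
  cob_boundary : range cob_in `|` range cob_out = boundary cob_manifold }.
Arguments cob_in {R X Y} _ _.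
Arguments cob_out {R X Y} _ _.

Definition cob_equiv (R : realType) (X Y : ob1Cob) (K L : cobordism R X Y) :
    Prop :=
  exists (f : K -> L) (g : L -> K),
    [/\ inverse_homeos [set: K] [set: L] f g, orientation_preserving f,
        (forall i, f (cob_in K i) = cob_in L i) &
        (forall j, f (cob_out K j) = cob_out L j)].

(* Equivalence classes are predicates [cobordism -> Prop]; [set] and the
   quotients of the library are too small for the universe of [cobordism]. *)
Definition hom1Cob (R : realType) (X Y : ob1Cob) : Type :=
  {C : cobordism R X Y -> Prop | exists K, C = cob_equiv K}.

Definition cob_class (R : realType) (X Y : ob1Cob) (K : cobordism R X Y) :
    hom1Cob R X Y :=
  exist _ (cob_equiv K) (ex_intro _ K erefl).

Lemma increasing_at_comp (R : realType) (M N P : topologicalType)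
    (c : chart R M) (d : chart R N) (e : chart R P) (f : M -> N) (g : N -> P) x :
  {for x, continuous f} -> increasing_at c d f x -> increasing_at d e g (f x) ->
  increasing_at c e (g \o f) x.
Proof.
move=> fx [W Wx cd] [V Vfx de]; exists (W `&` f @^-1` V).
  by apply: filterI => //; exact: fx.
by move=> y z [Wy Vy] [Wz Vz]; rewrite cd// de.
Qed.

Lemma setT_homeos_continuous (T U : topologicalType) (f : T -> U) (g : U -> T) :
  inverse_homeos [set: T] [set: U] f g ->
  [/\ continuous f, continuous g, cancel f g & cancel g f].
Proof.
move=> [fK gK cf cg].
have {}cf := (continuous_subspace_setT f).2 cf.
have {}cg := (continuous_subspace_setT g).2 cg.
split=> // x; first by case: (fK x I).
by case: (gK x I).
Qed.

Lemma cob_equiv_refl (R : realType) (X Y : ob1Cob) (K : cobordism R X Y) :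
  cob_equiv K K.
Proof.
exists id, id; split=> //.
  by split=> //; exact: continuous_subspaceT (fun x => cvg_id).
by move=> c d ? ? x ? ?; exact: atlas_oriented.
Qed.

Lemma cob_equiv_sym (R : realType) (X Y : ob1Cob) (K L : cobordism R X Y) :
  cob_equiv K L -> cob_equiv L K.
Proof.
move=> [f [g [fg of_ fin fout]]].
have [cf cg fK gK] := setT_homeos_continuous fg.
exists g, f; split.
- by case: fg => *; split.
- move=> d c ld kc y dy cgy.
  have [|W Wgy WE] := of_ c d kc ld (g y) cgy; first by rewrite gK.
  exists (g @^-1` W); first exact: cg.
  by move=> u v Wu Wv; rewrite [RHS]WE// !gK.
- by move=> i; rewrite -fin fK.
- by move=> j; rewrite -fout fK.
Qed.

Lemma cob_equiv_trans (R : realType) (X Y : ob1Cob) (K L P : cobordism R X Y) :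
  cob_equiv K L -> cob_equiv L P -> cob_equiv K P.
Proof.
move=> [f [g [fg of_ fin fout]]] [f' [g' [fg' of' fin' fout']]].
have [cf cg fK gK] := setT_homeos_continuous fg.
have [cf' cg' fK' gK'] := setT_homeos_continuous fg'.
exists (f' \o f), (g \o g'); split.
- split.
  + by move=> x _ /=; rewrite fK' fK.
  + by move=> x _ /=; rewrite gK gK'.
  + by apply: continuous_subspaceT => x; apply: continuous_comp; [exact: cf|exact: cf'].
  + by apply: continuous_subspaceT => x; apply: continuous_comp; [exact: cg'|exact: cg].
- move=> c e kc pe x cx ex.
  have [d ld dfx] := atlas_cover (f x).
  by apply: (increasing_at_comp (cf x) (of_ _ _ kc ld _ cx dfx) (of' _ _ ld pe _ dfx ex)).
- by move=> i /=; rewrite fin fin'.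
- by move=> j /=; rewrite fout fout'.
Qed.

Lemma cob_classP (R : realType) (X Y : ob1Cob) (K L : cobordism R X Y) :
  cob_class K = cob_class L <-> cob_equiv K L.
Proof.
split=> [/(congr1 sval) /= ->|KL]; first exact: cob_equiv_refl.
apply: eq_exist; apply: funext => P; apply: propext; split=> [|LP].
  exact/cob_equiv_trans/cob_equiv_sym.
exact: cob_equiv_trans LP.
Qed.

Definition cob_repr (R : realType) (X Y : ob1Cob) (K : hom1Cob R X Y) :
    cobordism R X Y :=
  sval (cid (svalP K)).

Lemma cob_reprK (R : realType) (X Y : ob1Cob) (K : hom1Cob R X Y) :
  cob_class (cob_repr K) = K.
Proof.
case: K => C CK; rewrite /cob_repr; case: cid => L /= CL.
exact/eq_exist/esym.
Qed.

Definition circle_components (R : realType) (M : oriented_manifold R) :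
    set (set M) :=
  [set C | (exists x, C = connected_component [set: M] x) /\
           homeomorphic C (circle R)].
Arguments circle_components {R} _.

(* [fset_set] is meaningful for finite sets only, but a compact manifold has
   finitely many components. *)
Definition nb_circles (R : realType) (M : oriented_manifold R) : nat :=
  #|` fset_set (circle_components M)|.

Definition cob_point (R : realType) (X Y : ob1Cob) (K : cobordism R X Y)
    (u : 'I_(ob_size X) + 'I_(ob_size Y)) : K :=
  match u with inl i => cob_in K i | inr j => cob_out K j end.

Definition same_component (R : realType) (X Y : ob1Cob) (K : cobordism R X Y)
    (u v : 'I_(ob_size X) + 'I_(ob_size Y)) : Prop :=
  connected_component [set: K] (cob_point K u) (cob_point K v).

(* The value at u of the i-th function m -> {0, ..., p - 1} in lexicographic
   order, i.e. the digit of i at position u in base p, the most significant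
   among m digits being at position 0. *)
Definition lex_fun (p m : nat) (i : 'I_(p ^ m)) (u : 'I_m) : nat :=
  ((i %/ p ^ (m - u.+1)) %% p)%N.

Lemma lex_fun_ltn (p m : nat) (i j : 'I_(p ^ m)) : (i < j)%N ->
  exists2 u : 'I_m, (forall v : 'I_m, (v < u)%N -> lex_fun i v = lex_fun j v) &
                    (lex_fun i u < lex_fun j u)%N.
Proof.
rewrite /lex_fun; case: i j => [i /= ip] [j /= jp].
elim: m i j ip jp => [|m IHm] i j ip jp ij.
  by move: jp ij; rewrite expn0 ltnS leqn0 => /eqP->.
have p0 : (0 < p)%N by rewrite lt0n; apply: contraTneq ip => ->; rewrite exp0n.
have [ij1|] := ltnP (i %/ p) (j %/ p).
  have divp k : (k < p ^ m.+1)%N -> (k %/ p < p ^ m)%N.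
    by rewrite ltn_divLR// -expnSr.
  have [u uE uL] := IHm _ _ (divp _ ip) (divp _ jp) ij1.
  have digit k (v : 'I_m) :
      (k %/ p ^ (m.+1 - (widen_ord (leqnSn m) v).+1) =
       k %/ p %/ p ^ (m - v.+1))%N.
    by rewrite -divnMA -expnS /= subSS subnSK// subSS.
  exists (widen_ord (leqnSn m) u); last by rewrite !digit.
  move=> v vu; have vm : (v < m)%N := ltn_trans vu (ltn_ord u).
  have -> : v = widen_ord (leqnSn m) (Ordinal vm) by exact: val_inj.
  by rewrite !digit; exact: uE.
move=> ji; have ij1 : (i %/ p = j %/ p)%N.
  by apply/eqP; rewrite eqn_leq ji leq_div2r// ltnW.
exists ord_max => [v vm|] /=.
  suff digit k : (k %/ p ^ (m.+1 - v.+1) = k %/ p %/ p ^ (m - v.+1))%N.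
    by rewrite !digit ij1.
  by rewrite -divnMA -expnS subSS subnSK.
rewrite subnn !divn1.
by move: ij; rewrite {1}(divn_eq i p) {1}(divn_eq j p) ij1 ltn_add2l.
Qed.

Definition copair (n m : nat) (g : 'I_n -> nat) (f : 'I_m -> nat)
    (u : 'I_n + 'I_m) : nat :=
  match u with inl i => g i | inr j => f j end.

Definition brauer_ob (p : nat) (X : ob1Cob) : nat := (p ^ ob_size X)%N.

Definition brauer_incidence (R : realType) (F : fieldType) (p : nat)
    (X Y : ob1Cob) (K : cobordism R X Y) :
    'M[F]_(brauer_ob p Y, brauer_ob p X) :=
  \matrix_(i, j)
    (`[< forall u v, same_component K u v ->
           copair (lex_fun j) (lex_fun i) u =
           copair (lex_fun j) (lex_fun i) v >])%:R.

Definition brauer_cob (R : realType) (F : fieldType) (p : nat)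
    (X Y : ob1Cob) (K : cobordism R X Y) :
    'M[F]_(brauer_ob p Y, brauer_ob p X) :=
  (p ^ nb_circles K)%:R *: brauer_incidence F p K.

(* The choice of a representative is irrelevant, see [brauer_class]. *)
Definition brauer (R : realType) (F : fieldType) (p : nat)
    (X Y : ob1Cob) (K : hom1Cob R X Y) :
    'M[F]_(brauer_ob p Y, brauer_ob p X) :=
  brauer_cob F p (cob_repr K).

Lemma image_connected_component (T U : topologicalType) (f : T -> U) x :
  continuous f ->
  f @` connected_component [set: T] x `<=` connected_component [set: U] (f x).
Proof.
move=> cf; apply: connected_component_max => //.
  by exists x => //; exact: connected_component_refl.
apply: connected_continuous_connected; first exact: component_connected.
exact: continuous_subspaceT.
Qed.

Lemma homeo_connected_component (T U : topologicalType) (f : T -> U)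
    (g : U -> T) x : inverse_homeos [set: T] [set: U] f g ->
  f @` connected_component [set: T] x = connected_component [set: U] (f x).
Proof.
move=> /setT_homeos_continuous[cf cg fK gK].
apply/seteqP; split; first exact: image_connected_component.
move=> y xy; exists (g y); last exact: gK.
rewrite -{1}(fK x); apply: (image_connected_component cg (x := f x)).
by exists y.
Qed.

Lemma same_component_equiv (R : realType) (X Y : ob1Cob)
    (K L : cobordism R X Y) u v :
  cob_equiv K L -> same_component K u v -> same_component L u v.
Proof.
move=> [f [g [/setT_homeos_continuous[cf _ _ _] _ fin fout]]] uv.
have fE w : f (cob_point K w) = cob_point L w by case: w => i /=.
rewrite /same_component -!fE; apply: (image_connected_component cf).
by exists (cob_point K v).
Qed.

Lemma within_continuous_comp (T U V : topologicalType) (A : set T) (B : set U)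
    (f : T -> U) (g : U -> V) :
  (forall x, A x -> B (f x)) ->
  {within A, continuous f} -> {within B, continuous g} ->
  {within A, continuous (g \o f)}.
Proof.
move=> AB /subspace_continuousP cf /subspace_continuousP cg.
apply/subspace_continuousP => x Ax W /(cg _ (AB _ Ax)) /(cf _ Ax) fgW.
by apply: (@filterS _ (nbhs x) _ _ _ _ fgW) => z /= + Az; apply=> //; exact: AB.
Qed.

Lemma homeo_circle_components (R : realType) (M N : oriented_manifold R)
    (f : M -> N) (g : N -> M) : inverse_homeos [set: M] [set: N] f g ->
  [set f @` C | C in circle_components M] `<=` circle_components N.
Proof.
move=> fg _ [C [[x Cx] [h [k [hk1 hk2 ch ck]]]] <-].
have [cf cg fK gK] := setT_homeos_continuous fg.
split; first by exists (f x); rewrite Cx (homeo_connected_component _ fg).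
exists (h \o g), (f \o k); split.
- by move=> _ [y Cy <-] /=; rewrite fK; have [? ->] := hk1 _ Cy.
- move=> z Bz /=; have [? hkz] := hk2 _ Bz; rewrite fK; split=> //.
  by exists (k z).
- apply: (within_continuous_comp (B := C)) => //.
  + by move=> _ [y Cy <-]; rewrite fK.
  + exact: continuous_subspaceT.
- apply: (within_continuous_comp (B := [set: M])) => //.
  exact: continuous_subspaceT.
Qed.

Lemma image_cancel (T U : Type) (f : T -> U) (g : U -> T) :
  cancel f g -> cancel (fun C : set T => f @` C) (fun D : set U => g @` D).
Proof.
move=> fK C; rewrite image_comp -[RHS]image_id.
by apply: eq_imagel => x _ /=; exact: fK.
Qed.

Lemma nb_circles_equiv (R : realType) (X Y : ob1Cob) (K L : cobordism R X Y) :
  cob_equiv K L -> nb_circles K = nb_circles L.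
Proof.
move=> [f [g [fg _ _ _]]].
have gf : inverse_homeos [set: L] [set: K] g f by case: fg => *; split.
have [_ _ fK gK] := setT_homeos_continuous fg.
have imI : injective (fun C : set K => f @` C) := can_inj (image_cancel fK).
rewrite /nb_circles; have -> : circle_components L = [set f @` C | C in circle_components K].
  apply/seteqP; split; last exact: (homeo_circle_components fg).
  move=> D LD; exists (g @` D).
    by apply: (homeo_circle_components gf); exists D.
  exact: image_cancel.
have [fin|inf] := pselect (finite_set (circle_components K)).
  by rewrite fset_set_image// card_imfset.
have infL : infinite_set [set f @` C | C in circle_components K].
  move=> /(finite_image (fun D : set L => g @` D)); rewrite image_comp.
  rewrite (_ : _ \o _ = id) ?image_id//; apply: funext => C /=.
  exact: image_cancel.
by rewrite /fset_set; do 2 case: pselect => //.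
Qed.

Lemma brauer_cob_equiv (R : realType) (F : fieldType) (p : nat) (X Y : ob1Cob)
    (K L : cobordism R X Y) :
  cob_equiv K L -> brauer_cob F p K = brauer_cob F p L.
Proof.
move=> KL; rewrite /brauer_cob (nb_circles_equiv KL); congr (_ *: _).
apply/matrixP => i j; rewrite !mxE; congr (nat_of_bool _)%:R.
apply: asbool_equiv_eq; split=> + u v uv; apply.
  exact/(same_component_equiv (cob_equiv_sym KL)).
exact: same_component_equiv uv.
Qed.

Lemma brauer_class (R : realType) (F : fieldType) (p : nat) (X Y : ob1Cob)
    (K : cobordism R X Y) : brauer F p (cob_class K) = brauer_cob F p K.
Proof. by apply/brauer_cob_equiv/cob_classP; rewrite cob_reprK. Qed.

(* Main.v *)
(** Since [p] is at least 2 and the characteristic is 0, the matrix of a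
    cobordism determines its number of circles (any constant pair of functions
    gives the entry [p ^ a]) and which of its boundary points lie in the same
    component (test with the indicator function of a component).  These data
    determine the cobordism by the classification of compact oriented
    1-manifolds, obtained as follows.  An immersed path is one which increases
    in every chart.  By compactness, following the orientation from any point
    leads to a terminal boundary point or to a closed immersed path, and
    likewise backwards to an initial boundary point.  A closed path contains a
    simple loop, and a path between boundary points which contains no loop is
    injective; by the intermediate value theorem the image is open in both
    cases, so it is a component.  Each component thus has a parameter
    [[0, 1] -> M], injective up to [0 ~ 1] in the case of a loop, and matching
    the parameters of two cobordisms gives the homeomorphism. *)

Require Import Defs.
From HB Require Import structures.
From mathcomp Require Import all_boot all_order all_algebra finmap.
From mathcomp Require Import all_classical all_reals all_analysis.
From mathcomp Require Import lra ring.

Set Implicit Arguments.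
Unset Strict Implicit.
Unset Printing Implicit Defensive.

Import Order.TTheory GRing.Theory Num.Theory.
Import numFieldNormedType.Exports.

Local Open Scope classical_set_scope.
Local Open Scope ring_scope.

(** * The invariants read off the matrix *)

Lemma lex_fun_inj (p m : nat) (i j : 'I_(p ^ m)) :
  lex_fun i =1 lex_fun j -> i = j.
Proof.
move=> ij; have [/lex_fun_ltn[u _]|/lex_fun_ltn[u _]|/val_inj//] := ltngtP i j.
  by rewrite ij ltnn.
by rewrite ij ltnn.
Qed.

(** The digit map is injective between finite types of the same cardinality [p ^ m], hence onto. *)
Lemma lex_fun_surj (p m : nat) (h : 'I_m -> nat) : (forall u, h u < p)%N ->
  exists i : 'I_(p ^ m), lex_fun i =1 h.
Proof.
case: p => [|p] hp.
  have m0 : m = 0%N by case: m h hp => // m h /(_ ord0).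
  by subst m; exists ord0 => -[].
pose digits (i : 'I_(p.+1 ^ m)) : {ffun 'I_m -> 'I_p.+1} :=
  [ffun u => inord (lex_fun i u)].
have digitsE i u : digits i u = lex_fun i u :> nat.
  by rewrite ffunE inordK// ltn_mod.
have digits_inj : injective digits.
  by move=> i j ij; apply: lex_fun_inj => u; rewrite -!digitsE ij.
have /codomP[i hi] : [ffun u => inord (h u)] \in codom digits.
  by apply: inj_card_onto; rewrite // card_ffun !card_ord.
by exists i => u; rewrite -digitsE -hi ffunE inordK.
Qed.

Lemma natr_inj_pchar0 (F : fieldType) : [pchar F] =i pred0 ->
  injective (GRing.natmul (1 : F)).
Proof.
move=> /pcharf0P F0.
have le_eq m n : (m <= n)%N -> m%:R = n%:R :> F -> m = n.
  move=> mn /esym/eqP; rewrite -subr_eq0 -natrB// F0 subn_eq0 => nm.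
  by apply/eqP; rewrite eqn_leq mn.
by move=> m n; have [/le_eq|/ltnW/le_eq nm /esym/nm] := leqP m n.
Qed.

Section BrauerInvariants.
Variables (R : realType) (F : fieldType) (p : nat) (X Y : ob1Cob).
Hypotheses (charF0 : [pchar F] =i pred0) (p_ge2 : (2 <= p)%N).
Variables K L : cobordism R X Y.
Hypothesis KL : brauer_cob F p K = brauer_cob F p L.

(** The zero functions are constant on every class, so their entry is [p ^ nb_circles];
    characteristic 0 and [2 <= p] recover the exponent. *)
Lemma brauer_cob_nb_circles : nb_circles K = nb_circles L.
Proof.
have p0 : (0 < p)%N by apply: ltn_trans p_ge2.
pose c0 n := cid (@lex_fun_surj p n (fun _ => 0%N) (fun _ => p0)).
have : brauer_cob F p K (sval (c0 _)) (sval (c0 _)) =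
       brauer_cob F p L (sval (c0 _)) (sval (c0 _)) by rewrite KL.
have E (M : cobordism R X Y) :
    brauer_cob F p M (sval (c0 _)) (sval (c0 _)) = (p ^ nb_circles M)%:R.
  rewrite !mxE asboolT ?mulr1// => u v _.
  by case: u v => [u|u] [v|v] /=; rewrite !(svalP (c0 _)).
by rewrite !E => /(natr_inj_pchar0 charF0)/eqP; rewrite eqn_exp2l// => /eqP.
Qed.

Lemma brauer_cob_same_component u v :
  same_component K u v -> same_component L u v.
Proof.
move=> Kuv; have p0 : (0 < p)%N by apply: ltn_trans p_ge2.
(* Indicator of the class of [u] in [L]; its values 0 and 1 are digits because [2 <= p]. *)
pose h w : nat := `[< same_component L u w >].
have hp w : (h w < p)%N by rewrite (leq_ltn_trans _ p_ge2)// leq_b1.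
have [j jE] := @lex_fun_surj p _ (h \o inl) (fun w => hp (inl w)).
have [i iE] := @lex_fun_surj p _ (h \o inr) (fun w => hp (inr w)).
have hE w : copair (lex_fun j) (lex_fun i) w = h w.
  by case: w => w /=; rewrite ?iE ?jE.
have : brauer_cob F p K i j = brauer_cob F p L i j by rewrite KL.
rewrite !mxE brauer_cob_nb_circles => /mulfI.
have -> : (p ^ nb_circles L)%:R != 0 :> F.
  apply/eqP => /(natr_inj_pchar0 charF0 (x2 := 0))/eqP.
  by rewrite expn_eq0 gtn_eqF.
move=> /(_ isT) KLij.
have : `[< forall w w', same_component L w w' ->
    copair (lex_fun j) (lex_fun i) w = copair (lex_fun j) (lex_fun i) w' >].
  apply/asboolP => w w' ww'; rewrite !hE /h; congr nat_of_bool.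
  apply: asbool_equiv_eq; rewrite /same_component.
  by split=> /connected_component_trans; apply=> //;
    exact: connected_component_sym.
(* The incidence entry of [L] is 1; if [h] were not constant on the classes of [K], that of [K]
   would be 0. Hence [h v = h u = 1]. *)
move: KLij; case: asboolP => [+ _ _|_ /eqP + H].
  move=> /(_ _ _ Kuv); rewrite !hE /h.
  rewrite (asboolT (connected_component_refl _))//.
  by case: asboolP.
by rewrite H eq_sym oner_eq0.
Qed.
End BrauerInvariants.

(** * Immersed paths *)

(** Both functions put the right half of [W] above [x] and the left half below, so points on
    different sides are compared through [x]. This joins one-sided monotonicity at a junction. *)
Lemma ltr_glue (R : realType) (T : Type) (x : T) (W : set T) (f g : T -> R) :
    W x ->
    (forall y z, W y -> W z -> f x <= f y -> f x <= f z ->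
      (f y < f z) = (g y < g z)) ->
    (forall y z, W y -> W z -> f y <= f x -> f z <= f x ->
      (f y < f z) = (g y < g z)) ->
  forall y z, W y -> W z -> (f y < f z) = (g y < g z).
Proof.
move=> Wx right left.
have ge y : W y -> f x <= f y -> g x <= g y.
  by move=> Wy xy; rewrite leNgt -right// ltNge xy.
have le y : W y -> f y <= f x -> g y <= g x.
  by move=> Wy xy; rewrite leNgt -left// ltNge xy.
move=> y z Wy Wz; have [xy|/ltW yx] := leP (f x) (f y);
  have [xz|/ltW zx] := leP (f x) (f z); [exact: right| | |exact: left].
- by rewrite !ltNge (le_trans zx xy) (le_trans (le _ Wz zx) (ge _ Wy xy)).
- have ryx := left _ _ Wy Wx yx (lexx _).
  have rxz := right _ _ Wx Wz (lexx _) xz.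
  have gyx := le _ Wy yx; have gxz := ge _ Wz xz.
  (* Here [y] is to the left and [z] to the right; if [f y = f x] then also [g y = g x], and [y] can
     be replaced with [x]. *)
  have [fyx|xfy] := ltP (f y) (f x).
    have : g y < g x by rewrite -ryx.
    by move=> gyx'; rewrite (lt_le_trans fyx xz) (lt_le_trans gyx' gxz).
  have fE : f y = f x by apply/le_anti; rewrite yx.
  have gE : g y = g x by apply/le_anti; rewrite gyx leNgt -ryx -leNgt.
  by rewrite fE gE.
Qed.

Section RealNbhs.
Variable R : realType.
Implicit Types (t b : R) (W : set R).

Lemma nbhs_right_segment t b W : nbhs t W -> t < b ->
  exists2 t', t < t' <= b & forall s, t <= s <= t' -> W s.
Proof.
move=> /nbhs_ballP[e /= e0 eW] tb.
exists (Num.min b (t + e / 2)).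
  by rewrite lt_min tb ge_min lexx ltrDl divr_gt0.
move=> s; rewrite le_min => /and3P[ts sb se]; apply: eW.
by rewrite /ball/= ler0_norm; lra.
Qed.

Lemma nbhs_left_segment t b W : nbhs t W -> b < t ->
  exists2 t', b <= t' < t & forall s, t' <= s <= t -> W s.
Proof.
move=> /nbhs_ballP[e /= e0 eW] tb.
exists (Num.max b (t - e / 2)).
  by rewrite le_max lexx gt_max tb; lra.
move=> s; rewrite ge_max => /andP[/andP[bs es] st]; apply: eW.
by rewrite /ball/= ger0_norm; lra.
Qed.
End RealNbhs.

(** * Coordinates in a chart *)

Section Charts.
Variables (R : realType) (M : topologicalType) (c : chart R M).

Lemma chart_continuous x : chart_dom c x -> {for x, continuous c}.
Proof.
move=> cx; case: (chart_homeo c) => _ _ /subspace_continuousP cc _.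
have := cc _ cx; rewrite within_interior//.
by have := chart_dom_open c => /interior_id ->.
Qed.

Lemma chartK x : chart_dom c x -> chart_inv c (c x) = x.
Proof. by case: (chart_homeo c) => h _ _ _ /h[]. Qed.

Lemma chart_cod_val x : chart_dom c x -> chart_cod c (c x).
Proof. by case: (chart_homeo c) => h _ _ _ /h[]. Qed.

Lemma chart_invK s : chart_cod c s -> c (chart_inv c s) = s.
Proof. by case: (chart_homeo c) => _ h _ _ /h[]. Qed.

Lemma chart_dom_inv s : chart_cod c s -> chart_dom c (chart_inv c s).
Proof. by case: (chart_homeo c) => _ h _ _ /h[]. Qed.

Lemma chart_inj x y : chart_dom c x -> chart_dom c y -> c x = c y -> x = y.
Proof. by move=> cx cy cxy; rewrite -(chartK cx) cxy chartK. Qed.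

Lemma chart_half_line x : chart_dom c x -> half_line (chart_side c) (c x).
Proof. by move=> /chart_cod_val; have [U _ ->] := chart_cod_open c; case. Qed.

Lemma chart_dom_nbhs x : chart_dom c x -> nbhs x (chart_dom c).
Proof.
by move=> cx; apply: open_nbhs_nbhs; split=> //; exact: chart_dom_open.
Qed.

(** The intermediate value theorem for [c \o g], pulled back to [M] by the injectivity of the
    chart. *)
Lemma chart_ivt (g : R -> M) s1 s2 y : continuous g -> s1 <= s2 ->
    (forall s, s1 <= s <= s2 -> chart_dom c (g s)) ->
    chart_dom c y -> c (g s1) <= c y <= c (g s2) ->
  exists2 s, s1 <= s <= s2 & g s = y.
Proof.
move=> gc s12 gdom ydom cy.
have [||s] := @IVT R (c \o g) s1 s2 (c y) s12.
- apply/subspace_continuousP => s /=; rewrite in_itv/= => s12'.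
  apply: cvg_within_filter; apply: continuous_comp; first exact: gc.
  exact/chart_continuous/gdom.
- by rewrite /= ge_min le_max; case/andP: cy => -> ->; rewrite orbT.
rewrite in_itv/= => s12' cgs; exists s => //.
by apply: chart_inj => //; exact: gdom.
Qed.
End Charts.

Section Immersions.
Variables (R : realType) (M : oriented_manifold R).
Implicit Types (c d : chart R M) (g : R -> M) (a b t : R) (x y z : M).

Definition rising_at c g a b t : Prop := exists2 W, nbhs t W &
  forall u v, W u -> W v -> a <= u <= b -> a <= v <= b ->
    (u < v) = (c (g u) < c (g v)).

(** Continuity is asked on the whole line, so that no subspace topology intervenes; monotonicity
    concerns [[a, b]] only, hence is one-sided at the ends. *)
Definition immersed g a b : Prop := continuous g /\
  forall c t, atlas M c -> a <= t <= b -> chart_dom c (g t) ->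
    rising_at c g a b t.

(** Changes of charts are locally increasing, so one chart around each point of a path is enough to
    test that it rises. *)
Lemma rising_at_chart c d g a b t : continuous g -> atlas M c -> atlas M d ->
  chart_dom c (g t) -> chart_dom d (g t) ->
  rising_at c g a b t -> rising_at d g a b t.
Proof.
move=> gc Mc Md cgt dgt [W Wt Wc].
have [V Vgt Vcd] := atlas_oriented Mc Md cgt dgt.
exists (W `&` g @^-1` V); first by apply: filterI => //; exact: gc.
by move=> u v [Wu Vu] [Wv Vv] uab vab; rewrite Wc// Vcd.
Qed.

Lemma immersedP g a b : continuous g ->
    (forall t, a <= t <= b -> exists c,
      [/\ atlas M c, chart_dom c (g t) & rising_at c g a b t]) ->
  immersed g a b.
Proof.
move=> gc h; split=> // d t Md tab dgt; have [c [Mc cgt cg]] := h t tab.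
exact: rising_at_chart cg.
Qed.

Lemma immersed_affine g a b k l a' b' : 0 < k -> immersed g a b ->
    (forall t, a' <= t <= b' -> a <= k * t + l <= b) ->
  immersed (fun t => g (k * t + l)) a' b'.
Proof.
move=> k0 [gc gr] ab.
have kc : continuous (fun t => k * t + l).
  by move=> t; apply: cvgD; [exact: mulrl_continuous|exact: cvg_cst].
split=> [t|c t Mc tab cgt].
  exact: (continuous_comp (kc t) (gc (k * t + l))).
have [W Wt Wc] := gr _ _ Mc (ab _ tab) cgt.
exists ((fun t => k * t + l) @^-1` W); first exact: kc.
by move=> u v Wu Wv /ab uab /ab vab; rewrite -Wc// ltrD2r ltr_pM2l.
Qed.

Lemma immersed_sub g a b a' b' :
  immersed g a b -> a <= a' -> b' <= b -> immersed g a' b'.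
Proof.
move=> gi aa bb.
have := immersed_affine (k := 1) (l := 0) (a' := a') (b' := b') ltr01 gi.
under [fun t => g _]eq_fun do rewrite mul1r addr0.
by apply=> t; rewrite mul1r addr0 => /andP[? ?]; lra.
Qed.

Lemma immersed_cat g1 g2 a b b' : a <= b <= b' ->
    immersed g1 a b -> immersed g2 b b' -> g1 b = g2 b ->
  immersed (fun t => if t <= b then g1 t else g2 t) a b'.
Proof.
move=> /andP[ab bc] [g1c g1r] [g2c g2r] g12; set g := (X in immersed X).
have gb : g b = g1 b by rewrite /g lexx.
have gl t : t <= b -> g t = g1 t by rewrite /g => ->.
have gr t : b <= t -> g t = g2 t.
  by rewrite /g le_eqVlt => /predU1P[<-|]; rewrite ?lexx// ltNge => /negPf->.
have gc : continuous g.
  move=> t W Wg; rewrite /= -[_ W]/(nbhs t (g @^-1` W)).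
  have [tb|bt|tb] := ltgtP t b.
  - have gW : nbhs t (g1 @^-1` W) by apply: g1c; rewrite -gl// ltW.
    by apply: filterS2 gW (lt_nbhsl tb) => u /= Wu /ltW/gl ->.
  - have gW : nbhs t (g2 @^-1` W) by apply: g2c; rewrite -gr// ltW.
    by apply: filterS2 gW (lt_nbhsr bt) => u /= Wu /ltW/gr ->.
  - have W1 : nbhs t (g1 @^-1` W) by apply: g1c; rewrite tb -gb -tb.
    have W2 : nbhs t (g2 @^-1` W) by apply: g2c; rewrite tb -g12 -gb -tb.
    by apply: filterS2 W1 W2 => u /= W1u W2u; rewrite /g; case: ifP.
split=> // e t Me tac egt; have [tb|bt|tb] := ltgtP t b.
- have [||W Wt We] := g1r e t Me; [lra|by rewrite -gl// ltW|].
  exists (W `&` [set u | u < b]).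
    by apply: filterI => //; exact: lt_nbhsl.
  move=> u v [Wu /= ub] [Wv /= vb] uac vac; rewrite !gl ?(ltW ub, ltW vb)//.
  by apply: We => //; lra.
- have [||W Wt We] := g2r e t Me; [lra|by rewrite -gr// ltW|].
  exists (W `&` [set u | b < u]).
    by apply: filterI => //; exact: lt_nbhsr.
  move=> u v [Wu /= ub] [Wv /= vb] uac vac; rewrite !gr ?(ltW ub, ltW vb)//.
  by apply: We => //; lra.
rewrite {}tb in tac egt *.
have [||V Vb Ve] := g1r e b Me; [lra|by rewrite -gb|].
have [||W Wb We] := g2r e b Me; [lra|by rewrite -g12 -gb|].
exists (V `&` W); first exact: filterI.
move=> u v VWu VWv uac vac.
(* At the junction, times before and after [b] are compared through [b] itself. *)
apply: (@ltr_glue R R b (V `&` W `&` [set t | a <= t <= b']) id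
  (e \o g)) => //=.
- by split; [split; exact: nbhs_singleton|].
- move=> {VWu VWv}y z [[_ Wy] yac] [[_ Wz] zac] yb zb.
  by rewrite !gr//; apply: We => //; lra.
- move=> {VWu VWv}y z [[Vy _] yac] [[Vz _] zac] yb zb.
  by rewrite !gl//; apply: Ve => //; lra.
Qed.

(** Clamping the time to [[s1, s2]] extends the lifted segment to a path continuous on the whole
    line. *)
Lemma immersed_chart c s1 s2 : atlas M c ->
    (forall s, s1 <= s <= s2 -> chart_cod c s) -> s1 <= s2 ->
  immersed (fun t => chart_inv c (Num.max s1 (Num.min t s2))) s1 s2.
Proof.
move=> Mc cod s12; set clamp := fun t : R => Num.max s1 (Num.min t s2).
have clamp_in t : s1 <= clamp t <= s2.
  by rewrite /clamp le_max lexx/= ge_max s12 ge_min lexx orbT.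
have clampE t : s1 <= t <= s2 -> Num.max s1 (Num.min t s2) = t.
  by move=> /andP[t1 t2]; rewrite min_l// max_r.
have clampc : continuous clamp.
  move=> t; apply: (@continuous_max R R (fun=> s1) (fun u => Num.min u s2)).
    exact: cvg_cst.
  apply: (@continuous_min R R id (fun=> s2)); [exact: cvg_id|exact: cvg_cst].
apply: immersedP => [t|t tin].
  case: (chart_homeo c) => _ _ _ /subspace_continuousP ic.
  move=> W /(ic _ (cod _ (clamp_in t))) icW.
  have cW : nbhs t
      (fun u => chart_cod c (clamp u) -> W (chart_inv c (clamp u))).
    exact: (clampc t) icW.
  by apply: (filterS _ cW) => u /=; apply; exact/cod/clamp_in.
exists c; split=> //; first exact/chart_dom_inv/cod/clamp_in.
exists setT; first exact: filterT.
by move=> u v _ _ uin vin; rewrite !clampE// !chart_invK//; exact: cod.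
Qed.

Lemma immersed_right g a b t c W : immersed g a b -> a <= t < b -> atlas M c ->
    chart_dom c (g t) -> nbhs t W ->
  exists t', [/\ t < t' <= b, c (g t) < c (g t') &
    forall s, t <= s <= t' -> W s /\ chart_dom c (g s)].
Proof.
move=> [gc gr] atb Mc cgt Wt.
have [|V Vt Vc] := gr c t Mc _ cgt; first lra.
have WVt : nbhs t (W `&` V `&` g @^-1` (chart_dom c)).
  by apply: filterI; [exact: filterI|exact/gc/chart_dom_nbhs].
have [|t' tt' h] := nbhs_right_segment (b := b) WVt; first lra.
exists t'; split=> // [|s /h[[]]//].
have [[_ Vt'] _] := h t' ltac:(lra).
by rewrite -Vc//; [lra|exact: nbhs_singleton|lra|lra].
Qed.

Lemma immersed_left g a b t c W : immersed g a b -> a < t <= b -> atlas M c ->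
    chart_dom c (g t) -> nbhs t W ->
  exists t', [/\ a <= t' < t, c (g t') < c (g t) &
    forall s, t' <= s <= t -> W s /\ chart_dom c (g s)].
Proof.
move=> [gc gr] atb Mc cgt Wt.
have [|V Vt Vc] := gr c t Mc _ cgt; first lra.
have WVt : nbhs t (W `&` V `&` g @^-1` (chart_dom c)).
  by apply: filterI; [exact: filterI|exact/gc/chart_dom_nbhs].
have [|t' tt' h] := nbhs_left_segment (b := a) WVt; first lra.
exists t'; split=> // [|s /h[[]]//].
have [[_ Vt'] _] := h t' ltac:(lra).
by rewrite -Vc//; [lra|exact: nbhs_singleton|lra|lra].
Qed.

(** By [chart_ivt] the path sweeps a one-sided neighbourhood of [g t]. Keeping the times in [W]
    makes it possible to compare two paths along the same times. *)
Lemma immersed_cover_right g a b t c W : immersed g a b -> a <= t < b ->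
    atlas M c -> chart_dom c (g t) -> nbhs t W ->
  \forall y \near g t, c (g t) <= c y ->
    exists s, [/\ W s, t <= s <= b & g s = y].
Proof.
move=> gi atb Mc cgt Wt.
have [t' [tt' ct' h]] := immersed_right gi atb Mc cgt Wt.
have cy : \forall y \near g t, c y < c (g t').
  exact: (chart_continuous cgt (lt_nbhsl ct')).
apply: filterS2 (chart_dom_nbhs cgt) cy => y ydom yt' ty.
have [||||s st gs] := @chart_ivt _ _ c g t t' y gi.1 => //.
- lra.
- by move=> s /h[].
- by rewrite ty ltW.
by exists s; split=> //; [case: (h _ st)|lra].
Qed.

Lemma immersed_cover_left g a b t c W : immersed g a b -> a < t <= b ->
    atlas M c -> chart_dom c (g t) -> nbhs t W ->
  \forall y \near g t, c y <= c (g t) ->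
    exists s, [/\ W s, a <= s <= t & g s = y].
Proof.
move=> gi atb Mc cgt Wt.
have [t' [tt' ct' h]] := immersed_left gi atb Mc cgt Wt.
have cy : \forall y \near g t, c (g t') < c y.
  exact: (chart_continuous cgt (lt_nbhsr ct')).
apply: filterS2 (chart_dom_nbhs cgt) cy => y ydom yt' ty.
have [||||s st gs] := @chart_ivt _ _ c g t' t y gi.1 => //.
- lra.
- by move=> s /h[].
- by rewrite ty ltW.
by exists s; split=> //; [case: (h _ st)|lra].
Qed.

(** Just after [t] the coordinate increases, whereas a terminal point has coordinate 0, the largest
    possible in its chart. *)
Lemma immersed_not_minus g a b t : immersed g a b -> a <= t < b ->
  ~ boundary_point minus (g t).
Proof.
move=> gi atb [c [Mc cm cgt c0]].
have [t' [tt' ct' gt']] := immersed_right gi atb Mc cgt filterT.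
have [_ /chart_half_line] := gt' t' ltac:(lra).
by rewrite cm/=; lra.
Qed.

Lemma immersed_not_plus g a b t : immersed g a b -> a < t <= b ->
  ~ boundary_point plus (g t).
Proof.
move=> gi atb [c [Mc cm cgt c0]].
have [t' [tt' ct' gt']] := immersed_left gi atb Mc cgt filterT.
have [_ /chart_half_line] := gt' t' ltac:(lra).
by rewrite cm/=; lra.
Qed.
End Immersions.

(** * Compactness: sinks, sources and loops *)

Lemma compact_nbhs_cover (T : topologicalType) (V : T -> set T) :
    compact [set: T] -> (forall x, nbhs x (V x)) ->
  exists s : seq T, forall y, exists2 x, x \in s & V x y.
Proof.
move=> cT nV; have [[x0 _]|T0] := pselect (exists x : T, True); last first.
  by exists [::] => y; case: T0; exists y.
(* The cover criterion is applied to [T] with base point [x0]; for the empty space the empty list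
   was enough. *)
pose PT := HB.pack_for ptopologicalType T (isPointed.Build T x0).
have : compact [set: PT] by [].
rewrite compact_cover => /(_ T setT (fun x => (V x)^°)).
case=> [x _|y _|D _ DV]; first exact: open_interior.
  by exists y => //; exact: nV.
exists D => y; have [x /= Dx xy] := DV y I.
by exists x => //; exact: interior_subset.
Qed.

(* A step leads from any point near x either to a sink e or strictly forward
   to a point e depending on x only; by compactness finitely many e suffice. *)
Lemma compact_sink_or_cycle (T : topologicalType) (r : T -> T -> Prop)
    (B : set T) : compact [set: T] ->
    (forall x y z, r x y -> r y z -> r x z) ->
    (forall x : T, exists e, (\forall y \near x, r y e) \/
       (B e /\ \forall y \near x, y = e \/ r y e)) ->
  forall x, exists z, (x = z \/ r x z) /\ (B z \/ r z z).
Proof.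
move=> cT rT /choice[e eP] x; apply: contrapT => no.
have noB z : x = z \/ r x z -> ~ B z by move=> xz Bz; apply: no; exists z; auto.
have nor z : x = z \/ r x z -> ~ r z z by move=> xz rz; apply: no; exists z; auto.
have rR y z : x = y \/ r x y -> r y z -> x = z \/ r x z.
  by move=> [->|xy] yz; right => //; exact: rT yz.
have [|s sP] := compact_nbhs_cover (V := fun z => [set y | r y (e z) \/
    (B (e z) /\ (y = e z \/ r y (e z)))]) cT.
  move=> z; case: (eP z) => [h|[Bz h]].
    by apply: filterS h => y; left.
  by apply: filterS h => y; right.
have step y : x = y \/ r x y -> exists2 z, z \in map e s & r y z.
  move=> xy; have [z zs h] := sP y; exists (e z); first exact: map_f.
  case: h => // -[Bz []] // yz.
  by case: (noB y) => //; rewrite yz.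
(* The list [s'] contains the candidates ahead of [y]. After a step to [z], transitivity keeps the
   later candidates in [s'], and [z] is no longer one since [r z z] is excluded; so the list shrinks
   until no step is possible. *)
suff loop n (s' : seq T) y : (size s' <= n)%N -> x = y \/ r x y ->
    (forall z, z \in map e s -> r y z -> z \in s') -> False.
  by apply: (loop (size (map e s)) (map e s) x) => //; left.
elim: n s' y => [|n IHn] s' y ns xy ys'; have [z zs yz] := step _ xy;
  have zs' := ys' _ zs yz; first by case: s' ns zs' {ys'}.
apply: (IHn (rem z s') z); first by rewrite size_rem// -subn1 leq_subLR.
  exact: rR yz.
move=> w ws zw; have ws' := ys' _ ws (rT _ _ _ yz zw).
have := perm_to_rem zs' => /perm_mem/(_ w); rewrite ws' inE => /esym.
case/orP => // /eqP wz; case: (nor z); first exact: rR yz.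
by rewrite -{2}wz.
Qed.

Lemma clopen_connected_component (T : topologicalType) (A : set T) x :
  open A -> closed A -> connected A -> A x ->
  connected_component [set: T] x = A.
Proof.
move=> oA cA conA Ax; apply/seteqP; split; last exact: connected_component_max.
have conC := @component_connected T setT x.
suff -> : connected_component [set: T] x =
          connected_component [set: T] x `&` A by exact: subIsetr.
apply/esym/conC; [|by exists A|by exists A].
by exists x; split=> //; exact: connected_component_refl.
Qed.

Lemma half_line_convex (R : realType) (s : sign) (u v w : R) :
  half_line s u -> half_line s v -> u <= w <= v -> half_line s w.
Proof. by case: s => /=; lra. Qed.

(** Near [c x] the codomain is the trace of a ball on a half-line, and both are convex. *)
Lemma chart_window (R : realType) (M : topologicalType) (c : chart R M) x :
    chart_dom c x ->
  exists2 e : R, 0 < e & forall u v w : R, `|u - c x| < e -> `|v - c x| < e ->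
    half_line (chart_side c) u -> half_line (chart_side c) v -> u <= w <= v ->
    chart_cod c w.
Proof.
move=> cx; have [U oU cE] := chart_cod_open c.
have : U (c x) by have := chart_cod_val cx; rewrite cE => -[].
move/oU => /nbhs_ballP[e /= e0 eU]; exists e => // u v w ue ve hu hv uwv.
rewrite cE; split; last exact: half_line_convex uwv.
by apply: eU; move: ue ve; rewrite /ball/= !ltr_norml; lra.
Qed.

(** * Paths following the orientation *)

Section Paths.
Variables (R : realType) (M : oriented_manifold R).
Implicit Types (c d : chart R M) (g : R -> M) (a b t : R) (x y z : M).

(** The time interval has positive length and rising is strict, so a constant path does not qualify:
    [path_to x x] means that a closed path passes through [x]. *)
Definition path_to x y : Prop :=
  exists2 g, immersed g 0 1 & g 0 = x /\ g 1 = y.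

Lemma immersed_unit g a b : a < b -> immersed g a b ->
  immersed (fun t => g ((b - a) * t + a)) 0 1.
Proof. by move=> ab gi; apply: immersed_affine gi _ => [|t tin]; nra. Qed.

Lemma immersed_path_to g a b : a < b -> immersed g a b -> path_to (g a) (g b).
Proof.
move=> ab gi; exists (fun t => g ((b - a) * t + a)); first exact: immersed_unit.
by rewrite mulr0 add0r mulr1 subrK.
Qed.

Lemma path_to_trans x y z : path_to x y -> path_to y z -> path_to x z.
Proof.
move=> [g gi [<- gy]] [h hi [hy <-]].
(* The second path is delayed to [[1, 2]]; the concatenation on [[0, 2]] is then rescaled. *)
have hi2 : immersed (fun t => h (1 * t + (- 1))) 1 2.
  by apply: immersed_affine hi _ => // t; lra.
have gh : g 1 = h (1 * 1 + -1) by rewrite mul1r subrr gy.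
have := immersed_path_to _ (immersed_cat _ gi hi2 gh).
rewrite ler01 (_ : 2 <= 1 = false) ?mul1r; last by apply/negP; lra.
by rewrite (_ : 2 - 1 = 1); [apply; lra|lra].
Qed.

Lemma chart_path_to c u v : atlas M c -> u < v ->
  (forall w, u <= w <= v -> chart_cod c w) ->
  path_to (chart_inv c u) (chart_inv c v).
Proof.
move=> Mc uv cod; have := immersed_path_to uv (immersed_chart Mc cod (ltW uv)).
by rewrite min_l ?(ltW uv)// maxxx min_r// max_r// ltW.
Qed.

Lemma chart_near c x e : chart_dom c x -> 0 < e ->
  \forall y \near x, chart_dom c y /\ `|c y - c x| < e.
Proof.
move=> cx e0.
have ce : \forall y \near x, `|c y - c x| < e.
  by move: e0; apply: cvgr_distC_lt; exact: chart_continuous.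
by apply: filterS2 (chart_dom_nbhs cx) ce => y; split.
Qed.

(** If the chart has a coordinate [v] above [c x], all points near [x] flow to the point of
    coordinate [v]. Otherwise [x] is terminal, and its neighbours flow to [x]. *)
Lemma local_forward x : exists z, (\forall y \near x, path_to y z) \/
  (boundary_point minus z /\ \forall y \near x, y = z \/ path_to y z).
Proof.
have [c Mc cx] := atlas_cover x.
have [e e0 eW] := chart_window cx; have xh := chart_half_line cx.
have [[v [xv ve vh]]|no] := pselect (exists v,
    [/\ c x < v, `|v - c x| < e & half_line (chart_side c) v]).
  exists (chart_inv c v); left.
  have ve0 : 0 < Num.min e (v - c x) by rewrite lt_min e0/= subr_gt0.
  apply: filterS (chart_near cx ve0) => y [ydom]; rewrite lt_min => /andP[ye yv].
  rewrite -{1}(chartK ydom); apply: chart_path_to => //.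
    by move: yv; rewrite ltr_norml; lra.
  by move=> w; apply: eW => //; exact: chart_half_line.
(* In any other situation [c x + e / 2], cut off at 0 on the side [minus], would be a coordinate
   above [c x]. *)
have [side cx0] : chart_side c = minus /\ c x = 0.
  case: (chart_side c) xh no => /= xh no.
    by case: no; exists (c x + e / 2); rewrite ltr_norml; split; lra.
  split=> //; apply/le_anti/andP; split=> //; rewrite leNgt; apply/negP => x0.
  case: no; exists (Num.min 0 (c x + e / 2)); rewrite ltr_norml.
  have [|] := leP 0 (c x + e / 2) => ?; split; lra.
exists x; right; split; first by exists c.
apply: filterS (chart_near cx e0) => y [ydom ye].
have := chart_half_line ydom; rewrite {1}side /= le_eqVlt => /predU1P[y0|y0].
  by left; apply: (chart_inj ydom cx); rewrite y0 cx0.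
right; rewrite -(chartK ydom) -(chartK cx); apply: chart_path_to => //.
  by rewrite cx0.
move=> w; apply: eW => //; first by rewrite subrr normr0.
exact: chart_half_line.
Qed.

(** Mirror image of [local_forward]: room is sought below [c x]. *)
Lemma local_backward x : exists z, (\forall y \near x, path_to z y) \/
  (boundary_point plus z /\ \forall y \near x, y = z \/ path_to z y).
Proof.
have [c Mc cx] := atlas_cover x.
have [e e0 eW] := chart_window cx; have xh := chart_half_line cx.
have [[v [xv ve vh]]|no] := pselect (exists v,
    [/\ v < c x, `|v - c x| < e & half_line (chart_side c) v]).
  exists (chart_inv c v); left.
  have ve0 : 0 < Num.min e (c x - v) by rewrite lt_min e0/= subr_gt0.
  apply: filterS (chart_near cx ve0) => y [ydom]; rewrite lt_min => /andP[ye yv].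
  rewrite -{1}(chartK ydom); apply: chart_path_to => //.
    by move: yv; rewrite ltr_norml; lra.
  by move=> w; apply: eW => //; exact: chart_half_line.
have [side cx0] : chart_side c = plus /\ c x = 0.
  case: (chart_side c) xh no => /= xh no; last first.
    by case: no; exists (c x - e / 2); rewrite ltr_norml; split; lra.
  split=> //; apply/le_anti/andP; split=> //; rewrite leNgt; apply/negP => x0.
  case: no; exists (Num.max 0 (c x - e / 2)); rewrite ltr_norml.
  have [|] := leP 0 (c x - e / 2) => ?; split; lra.
exists x; right; split; first by exists c.
apply: filterS (chart_near cx e0) => y [ydom ye].
have := chart_half_line ydom; rewrite {1}side /= le_eqVlt => /predU1P[y0|y0].
  by left; apply: (chart_inj ydom cx); rewrite -y0 cx0.
right; rewrite -(chartK ydom) -(chartK cx); apply: chart_path_to => //.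
  by rewrite cx0.
move=> w; apply: eW => //; first by rewrite subrr normr0.
exact: chart_half_line.
Qed.

(** A chart at an initial point contains a path leaving it, and no immersed path leaves a terminal
    point. *)
Lemma boundary_plus_not_minus x :
  boundary_point plus x -> ~ boundary_point minus x.
Proof.
move=> [c [Mc side cx cx0]]; have [e e0 eW] := chart_window cx.
rewrite -(chartK cx).
have : path_to (chart_inv c (c x)) (chart_inv c (c x + e / 2)).
  apply: chart_path_to => //; first by rewrite ltrDl divr_gt0.
  by move=> w win; apply: (eW (c x) (c x + e / 2));
    rewrite ?side ?cx0 ?ltr_norml /=; lra.
by move=> [g gi [<- _]]; apply: (immersed_not_minus gi); lra.
Qed.

Lemma sink_or_closed_path x : exists z, (x = z \/ path_to x z) /\
  (boundary_point minus z \/ path_to z z).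
Proof.
exact/compact_sink_or_cycle/local_forward/path_to_trans/carrier_compact.
Qed.

Lemma source_or_closed_path x : exists z, (x = z \/ path_to z x) /\
  (boundary_point plus z \/ path_to z z).
Proof.
apply: (compact_sink_or_cycle (r := fun y z => path_to z y)).
- exact: carrier_compact.
- by move=> u v w uv vw; exact: path_to_trans uv.
- exact: local_backward.
Qed.

Lemma path_to_connected x y : path_to x y -> connected_component setT x y.
Proof.
move=> [g [gc _] [<- <-]].
have gcon : connected (g @` `[0, 1]).
  apply: connected_continuous_connected; first exact: segment_connected.
  exact: continuous_subspaceT.
apply: (connected_component_max _ _ gcon) => //.
  by exists 0 => //=; rewrite in_itv/= lexx ler01.
by exists 1 => //=; rewrite in_itv/= lexx ler01.
Qed.

Lemma immersed_locally_injective g a b t : immersed g a b -> a <= t <= b ->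
  exists2 W, nbhs t W & forall u v, W u -> W v -> a <= u <= b -> a <= v <= b ->
    g u = g v -> u = v.
Proof.
move=> [_ gr] tab; have [c Mc cgt] := atlas_cover (g t).
have [W Wt Wc] := gr _ _ Mc tab cgt; exists W => // u v Wu Wv uab vab guv.
by apply/le_anti; rewrite !leNgt (Wc u v)// (Wc v u)// guv ltxx.
Qed.

(* Coincidences u < v of an immersed path form a compact set, by local
   injectivity; a pair with v - u minimal bounds a simple loop. *)
Lemma simple_subloop g a b u v : immersed g a b -> a <= u -> u < v -> v <= b ->
    g u = g v ->
  exists s t, [/\ a <= s, s < t, t <= b, g s = g t &
    forall s' t', s <= s' -> s' < t' -> t' <= t -> g s' = g t' ->
      s' = s /\ t' = t].
Proof.
move=> gi au uv vb guv.
pose D := [set p : R * R | [/\ a <= p.1, p.1 < p.2, p.2 <= b & g p.1 = g p.2]].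
have gf : continuous (g \o fst : R * R -> M).
  by move=> p; apply: continuous_comp; [exact: cvg_fst|exact: gi.1].
have gs : continuous (g \o snd : R * R -> M).
  by move=> p; apply: continuous_comp; [exact: cvg_snd|exact: gi.1].
have near1 (p : R * R) (W : set R) : nbhs p.1 W -> nbhs p [set q | W q.1].
  by move=> Wp; exact: (@cvg_fst _ _ (nbhs p.1) (nbhs p.2) _ W Wp).
have near2 (p : R * R) (W : set R) : nbhs p.2 W -> nbhs p [set q | W q.2].
  by move=> Wp; exact: (@cvg_snd _ _ (nbhs p.1) (nbhs p.2) _ W Wp).
have cD : compact D.
  apply: (@subclosed_compact _ _ (`[a, b] `*` `[a, b])); first last.
  - by move=> [p q] [/= ap pq qb _]; split; rewrite /= in_itv/=; lra.
  - by apply: compact_setX; exact: segment_compact.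
  rewrite -openC openE => -[p q] /= nD; rewrite /interior.
  have [pa|ap] := ltP p a.
    apply: filterS (near1 (p, q) _ (lt_nbhsl pa)) => -[p' q'] /= p'a [/=].
    by rewrite leNgt p'a.
  have [bq|qb] := ltP b q.
    apply: filterS (near2 (p, q) _ (lt_nbhsr bq)) => -[p' q'] /= bq' [/= _ _].
    by rewrite leNgt bq'.
  have [qp|pq] := ltP q p.
    pose m := (p + q) / 2.
    have mp : m < p by rewrite /m; lra.
    have qm : q < m by rewrite /m; lra.
    apply: filterS2 (near1 (p, q) _ (lt_nbhsr mp)) (near2 (p, q) _ (lt_nbhsl qm)).
    by move=> [p' q'] /= mp' qm' [/= _ pq' _ _]; lra.
  (* The condition [p.1 < p.2] in [D] is strict, yet [D] is closed: local injectivity clears a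
     neighbourhood of each diagonal point, and separation one of each pair with distinct images. *)
  have [gpq|gpq] := eqVneq (g p) (g q).
    have pq' : p = q.
      apply/le_anti; rewrite pq leNgt; apply/negP => pq'; exact: nD.
    have [|W Wp Wi] := immersed_locally_injective (t := p) gi; first lra.
    have Wq : nbhs (p, q).2 W by rewrite /= -pq'.
    apply: filterS2 (near1 (p, q) _ Wp) (near2 (p, q) _ Wq).
    move=> [p' q'] /= Wp' Wq' [/= ap' pq'' qb' gpq'].
    by have := Wi p' q' Wp' Wq' ltac:(lra) ltac:(lra) gpq'; lra.
  have := @carrier_hausdorff _ M; rewrite open_hausdorff => /(_ _ _ gpq).
  move=> [[U V] /= [gpU gqV] [oU oV UV]].
  have Up : nbhs (p, q) [set w | U (g w.1)].
    by apply: (gf (p, q)); apply: open_nbhs_nbhs; split=> //; exact/set_mem.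
  have Vq : nbhs (p, q) [set w | V (g w.2)].
    by apply: (gs (p, q)); apply: open_nbhs_nbhs; split=> //; exact/set_mem.
  apply: filterS2 Up Vq => -[p' q'] /= Up' Vq' [/= _ _ _ gpq'].
  have : (U `&` V) (g p') by split=> //; rewrite gpq'.
  by rewrite (eqP UV).
have [||[s t] /set_mem[/= sa st tb gst] min] :=
    @compact_EVT_min _ R (fun p : R * R => p.2 - p.1) D _ cD.
- by exists (u, v).
- apply: continuous_subspaceT => p.
  by apply: cvgB; [exact: cvg_snd|exact: cvg_fst].
exists s, t; split=> // s' t' ss st' tt gst'.
have : t - s <= t' - s' by apply: (min (s', t')); apply/mem_set; split=> //=; lra.
by lra.
Qed.

(** Equality in the model of a component: the segment, or the segment with its ends identified when
    [loop] holds. *)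
Definition same_fiber (loop : bool) (s t : R) : Prop :=
  s = t \/ loop /\ (s = 0 /\ t = 1 \/ s = 1 /\ t = 0).

(** The last clause is what makes the image of a segment open at its two ends. *)
Definition component_param (loop : bool) g : Prop :=
  [/\ immersed g 0 1,
      (forall s t, 0 <= s <= 1 -> 0 <= t <= 1 ->
        (g s = g t <-> same_fiber loop s t)) &
      ~~ loop -> boundary_point plus (g 0) /\ boundary_point minus (g 1)].

Lemma simple_loop_param g s t : immersed g s t -> s < t -> g s = g t ->
    (forall s' t', s <= s' -> s' < t' -> t' <= t -> g s' = g t' ->
      s' = s /\ t' = t) ->
  component_param true (fun u => g ((t - s) * u + s)).
Proof.
move=> gi st gst inj; split=> //; first exact: immersed_unit.
have inj' u v : 0 <= u -> u < v -> v <= 1 ->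
    g ((t - s) * u + s) = g ((t - s) * v + s) -> u = 0 /\ v = 1.
  move=> u0 uv v1 guv.
  have [|||us vt] := inj _ _ _ _ _ guv; [nra|nra|nra|].
  by split; nra.
move=> u v u01 v01; split=> [guv|[->//|[_ [][-> ->]]]]; last first.
- by rewrite mulr0 mulr1 add0r subrK.
- by rewrite mulr0 mulr1 add0r subrK.
have [uv|vu|] := ltgtP u v; last by left.
- by right; split=> //; left; apply: inj' => //; lra.
- right; split=> //; right.
  by have [| |-> ->//] := inj' _ _ _ vu _ (esym guv); lra.
Qed.
End Paths.

(** * Parametrized components *)

Section ComponentParam.
Variables (R : realType) (M : oriented_manifold R).
Implicit Types (c d : chart R M) (g : R -> M) (a b t : R) (x y z : M).

(** Clear in a chart [d] showing [x] as terminal, since its coordinates are at most [d x = 0]; the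
    change of charts, being increasing, carries this over to [c]. *)
Lemma boundary_minus_near c x : boundary_point minus x -> atlas M c ->
  chart_dom c x -> \forall y \near x, c y <= c x.
Proof.
move=> [d [Md side dx dx0]] Mc cx.
have [W Wx Wcd] := atlas_oriented Mc Md cx dx.
have W_x := nbhs_singleton Wx.
apply: filterS2 Wx (chart_dom_nbhs dx) => y Wy /chart_half_line.
by rewrite side /= -dx0 !leNgt Wcd.
Qed.

Lemma boundary_plus_near c x : boundary_point plus x -> atlas M c ->
  chart_dom c x -> \forall y \near x, c x <= c y.
Proof.
move=> [d [Md side dx dx0]] Mc cx.
have [W Wx Wcd] := atlas_oriented Mc Md cx dx.
have W_x := nbhs_singleton Wx.
apply: filterS2 Wx (chart_dom_nbhs dx) => y Wy /chart_half_line.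
by rewrite side /= -dx0 !leNgt Wcd.
Qed.

Section Param.
Variables (loop : bool) (g : R -> M).
Hypothesis gP : component_param loop g.

Let gi : immersed g 0 1. Proof. by case: gP. Qed.

Lemma param_fiber s t : 0 <= s <= 1 -> 0 <= t <= 1 ->
  (g s = g t <-> same_fiber loop s t).
Proof. by case: gP => _ + _; apply. Qed.

Lemma param_loop : loop -> g 0 = g 1.
Proof. by move=> lp; apply/param_fiber; [lra|lra|right; split=> //; left]. Qed.

(** Only time 1 has no future in [[0, 1]]: in a loop it is replaced with time 0, otherwise it gives
    a terminal point. *)
Lemma param_right t : 0 <= t <= 1 ->
  boundary_point minus (g t) \/ exists2 t', 0 <= t' < 1 & g t' = g t.
Proof.
move=> t01; have [t1|t1] := ltP t 1; first by right; exists t => //; lra.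
have -> : t = 1 by lra.
case: (boolP loop) => [/param_loop g01|nl].
  by right; exists 0 => //; lra.
by left; case: gP => _ _ /(_ nl)[].
Qed.

Lemma param_left t : 0 <= t <= 1 ->
  boundary_point plus (g t) \/ exists2 t', 0 < t' <= 1 & g t' = g t.
Proof.
move=> t01; have [t0|t0] := ltP 0 t; first by right; exists t => //; lra.
have -> : t = 0 by lra.
case: (boolP loop) => [/param_loop g01|nl].
  by right; exists 1 => //; lra.
by left; case: gP => _ _ /(_ nl)[].
Qed.

(** The path leaves [g t] at every time [t < 1], and in a loop it also leaves [g 1 = g 0]. *)
Lemma param_minus t : 0 <= t <= 1 -> boundary_point minus (g t) ->
  ~~ loop /\ t = 1.
Proof.
move=> t01 gt.
have t1 : t = 1.
  have [t1|] := ltP t 1; last by lra.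
  by case: (immersed_not_minus gi _ gt); lra.
split=> //; apply/negP => /param_loop g01; move: gt; rewrite t1 -g01.
by apply: (immersed_not_minus gi); lra.
Qed.

Lemma param_plus t : 0 <= t <= 1 -> boundary_point plus (g t) ->
  ~~ loop /\ t = 0.
Proof.
move=> t01 gt.
have t0 : t = 0.
  have [t0|] := ltP 0 t; last by lra.
  by case: (immersed_not_plus gi _ gt); lra.
split=> //; apply/negP => /param_loop g01; move: gt; rewrite t0 g01.
by apply: (immersed_not_plus gi); lra.
Qed.

(** In a chart at [g t], the points above are swept by the path going forward and those below by the
    path going backward; at a boundary point one side is reduced to [g t]. *)
Lemma param_open : open (g @` `[0, 1]).
Proof.
rewrite openE => _ [t t01 <-]; rewrite /interior.
have {}t01 : 0 <= t <= 1 by move: t01; rewrite /= in_itv.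
have [c Mc cgt] := atlas_cover (g t).
have right : \forall y \near g t, c (g t) <= c y -> (g @` `[0, 1]) y.
  case: (param_right t01) => [m|[t' t01' gt']].
    apply: filterS2 (chart_dom_nbhs cgt) (boundary_minus_near m Mc cgt).
    move=> y ydom yt ty; exists t; first by rewrite /= in_itv.
    by apply: (chart_inj cgt ydom); apply/le_anti; rewrite yt ty.
  rewrite -gt' in cgt *.
  apply: filterS (immersed_cover_right gi t01' Mc cgt filterT) => y h.
  move=> /h[s [_ s01 gs]]; exists s => //=.
  by rewrite in_itv/=; lra.
have left : \forall y \near g t, c y <= c (g t) -> (g @` `[0, 1]) y.
  case: (param_left t01) => [m|[t' t01' gt']].
    apply: filterS2 (chart_dom_nbhs cgt) (boundary_plus_near m Mc cgt).
    move=> y ydom yt ty; exists t; first by rewrite /= in_itv.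
    by apply: (chart_inj cgt ydom); apply/le_anti; rewrite yt ty.
  rewrite -gt' in cgt *.
  apply: filterS (immersed_cover_left gi t01' Mc cgt filterT) => y h.
  move=> /h[s [_ s01 gs]]; exists s => //=.
  by rewrite in_itv/=; lra.
apply: filterS2 right left => y.
by case: (leP (c y) (c (g t))) => [? _|/ltW ? + _]; apply.
Qed.

(** The image is open, closed as a compact set of a Hausdorff space, and connected. *)
Lemma param_component t : 0 <= t <= 1 ->
  connected_component [set: M] (g t) = g @` `[0, 1].
Proof.
move=> t01; have gc := continuous_subspaceT gi.1.
apply: clopen_connected_component.
- exact: param_open.
- apply: compact_closed; first exact: carrier_hausdorff.
  exact: continuous_compact (@segment_compact _ 0 1).
- exact: connected_continuous_connected (@segment_connected _ 0 1) _.
- by exists t => //=; rewrite in_itv.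
Qed.

End Param.

Lemma immersed_component_param g : immersed g 0 1 ->
    (boundary_point plus (g 0) /\ boundary_point minus (g 1)) \/ g 0 = g 1 ->
  exists loop h, component_param loop h /\
    exists2 t, 0 <= t <= 1 & connected_component setT (g 0) (h t).
Proof.
move=> gi g01.
have [[u [v [u0 uv v1 guv]]]|inj] := pselect (exists u v,
    [/\ 0 <= u, u < v, v <= 1 & g u = g v]).
  have [s [t [s0 st t1 gst min]]] := simple_subloop gi u0 uv v1 guv.
  exists true, (fun u => g ((t - s) * u + s)); split.
    by apply: simple_loop_param => //; apply: immersed_sub gi _ _ => //; lra.
  exists 0; first by lra.
  rewrite mulr0 add0r; move: s0; rewrite le_eqVlt => /predU1P[<-|s0].
    exact: connected_component_refl.
  apply: path_to_connected; apply: immersed_path_to => //.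
  by apply: immersed_sub gi _ _ => //; lra.
(* A closed path has the coincidence of times 0 and 1, so an injective one joins boundary points. *)
case: g01 => [g01|g01]; last first.
  by case: inj; exists 0, 1; split=> //; lra.
exists false, g; split; last first.
  by exists 0; [lra|exact: connected_component_refl].
split=> // s t s01 t01; split=> [gst|[->//|[]//]].
left; have [st|ts|//] := ltgtP s t; case: inj; [exists s, t|exists t, s];
  by split=> //; lra.
Qed.

(** If the search forward or backward from [x] meets a closed path, that path yields a parameter;
    otherwise [x] lies between a source [w] and a sink [z], and a path from [w] to [z] yields
    one. *)
Theorem component_param_ex x : exists loop g, component_param loop g /\
  connected_component [set: M] x = g @` `[0, 1].
Proof.
suff [loop [g [gP [t t01 xgt]]]] : exists loop g, component_param loop g /\
    exists2 t, 0 <= t <= 1 & connected_component setT x (g t).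
  exists loop, g; split=> //.
  by rewrite (same_connected_component xgt) (param_component gP).
have conn y : x = y \/ path_to x y -> connected_component setT x y.
  by move=> [<-|/path_to_connected//]; exact: connected_component_refl.
have conn' y : x = y \/ path_to y x -> connected_component setT x y.
  move=> [<-|/path_to_connected/connected_component_sym//].
  exact: connected_component_refl.
have closed z : connected_component setT x z -> path_to z z -> exists loop g,
    component_param loop g /\
    exists2 t, 0 <= t <= 1 & connected_component setT x (g t).
  move=> xz [g gi [g0 g1]]; have [|l [h [hP [t t01 ht]]]] :=
    immersed_component_param gi; first by right; rewrite g0.
  exists l, h; split=> //; exists t => //.
  by apply: connected_component_trans ht; rewrite g0.
have [z [xz [zm|/closed]]] := sink_or_closed_path x; last by apply; exact: conn.
have [w [xw [wp|/closed]]] := source_or_closed_path x; last by apply; exact: conn'.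
(* The case [w = x = z] is excluded: a point is not both initial and terminal. *)
have [g gi [g0 g1]] : path_to w z.
  case: xw wp xz zm => [<-|wx] wp [<-|xz] zm //; last exact: path_to_trans xz.
  by case: (boundary_plus_not_minus wp).
have [|l [h [hP [t t01 ht]]]] := immersed_component_param gi.
  by left; rewrite g0 g1.
exists l, h; split=> //; exists t => //.
by apply: connected_component_trans ht; rewrite g0; exact: conn'.
Qed.

End ComponentParam.

(** * Maps factored through a parametrized segment *)

Section Quotients.
Variables (R : realType) (T U : topologicalType).
Hypothesis hT : hausdorff_space T.

(** From the compact segment to a Hausdorff space [g] is a closed map, hence a quotient map onto its
    image, and continuity descends from [e] to [f]. *)
Lemma segment_factor_continuous (g : R -> T) (e : R -> U) (f : T -> U) :
    continuous g -> continuous e ->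
    (forall t : R, 0 <= t <= 1 -> f (g t) = e t) ->
  {within g @` `[0, 1], continuous f}.
Proof.
move=> gc ec fg; apply/subspace_continuousP => _ [t t01 <-] W.
have itvE (s : R) : `[0, 1]%classic s -> 0 <= s <= 1 by rewrite /= in_itv.
rewrite nbhsE => -[V [oV /= Vgt] VW].
pose A := `[0, 1] `&` e @^-1` (~` V).
have cA : compact A.
  apply: compact_closedI; first exact: segment_compact.
  by apply: closed_comp => [? _|]; [exact: ec|exact: open_closedC].
have oB : open (~` (g @` A)).
  apply: closed_openC; apply: compact_closed hT _.
  exact/continuous_compact/cA/continuous_subspaceT.
have Bgt : nbhs (g t) (~` (g @` A)).
  apply: open_nbhs_nbhs; split=> // -[s [s01 Ves] gst]; apply: Ves.
  by rewrite /= -(fg s (itvE _ s01)) gst.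
apply: filterS Bgt => y By [s s01 gs]; apply: VW.
suff : V (f y) by [].
rewrite -gs fg; last exact: itvE.
by apply: contrapT => nV; apply: By; exists s.
Qed.

Lemma segment_factor (g : R -> T) (e : R -> U) :
    (forall s t : R, 0 <= s <= 1 -> 0 <= t <= 1 -> g s = g t -> e s = e t) ->
  exists f : T -> U, forall t : R, 0 <= t <= 1 -> f (g t) = e t.
Proof.
(* Some preimage under [g] is selected; off the image of the segment the default time is 0. *)
move=> ge; exists (fun x => e (xget 0 [set t | 0 <= t <= 1 /\ g t = x])) => t t01.
by case: xgetP => [s -> [s01 gst]|/(_ t)[]//]; exact: ge.
Qed.
End Quotients.

(** Both images are the quotient of the segment by the same relation, so each parameter factors
    through the other. *)
Lemma homeomorphic_images (R : realType) (T U : topologicalType) (g : R -> T)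
    (e : R -> U) : hausdorff_space T -> hausdorff_space U ->
    continuous g -> continuous e ->
    (forall s t : R, 0 <= s <= 1 -> 0 <= t <= 1 -> g s = g t <-> e s = e t) ->
  homeomorphic (g @` `[0, 1]) (e @` `[0, 1]).
Proof.
move=> hT hU gc ec ge.
have [f fg] := segment_factor (fun s t s01 t01 => (ge s t s01 t01).1).
have [h he] := segment_factor (fun s t s01 t01 => (ge s t s01 t01).2).
have itvE (s : R) : `[0, 1]%classic s -> 0 <= s <= 1 by rewrite /= in_itv.
exists f, h; split.
- by move=> _ [t /itvE t01 <-]; rewrite fg// he//; split=> //; exists t.
- by move=> _ [t /itvE t01 <-]; rewrite he// fg//; split=> //; exists t.
- exact: segment_factor_continuous ec fg.
- exact: segment_factor_continuous gc he.
Qed.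

(** * The circle and its parameter *)

Section Circle.
Variable R : realType.

Definition circle_param (t : R) : R * R :=
  (cos (2 * pi * t), sin (2 * pi * t)).

Lemma circle_param_continuous : continuous circle_param.
Proof.
have lc : continuous (fun t : R => 2 * pi * t) by exact: mulrl_continuous.
move=> t; apply: (@cvg_pair _ _ _ _ (nbhs (cos (2 * pi * t)))
    (nbhs (sin (2 * pi * t)))).
  by apply: (@continuous_comp _ _ _ (fun t : R => 2 * pi * t) cos);
    [exact: lc|exact: continuous_cos].
by apply: (@continuous_comp _ _ _ (fun t : R => 2 * pi * t) sin);
  [exact: lc|exact: continuous_sin].
Qed.

Lemma circle_param_in t : circle R (circle_param t).
Proof. by rewrite /circle /= cos2Dsin2. Qed.

Lemma circle_param01 : circle_param 0 = circle_param 1.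
Proof.
rewrite /circle_param mulr0 mulr1 cos0 sin0 mulr_natl.
by rewrite cos2pi sin2pi.
Qed.

Lemma circle_param_surj : circle_param @` `[0, 1] = circle R.
Proof.
apply/seteqP; split=> [_ [t _ <-]|[x y] /= xy]; first exact: circle_param_in.
have pi0 := pi_gt0 R.
have x1 : -1 <= x <= 1.
  rewrite -ler_norml -(@ler_pXn2r _ 2)// ?nnegrE// real_normK ?num_real//.
  by rewrite expr1n -xy lerDl sqr_ge0.
have [a0 ax] := acos_def x1.
have ay : sin (acos x) = `|y|.
  by rewrite sin_acos// -xy addrC addKr sqrtr_sqr.
have a01 : 0 <= acos x / (2 * pi) <= 1.
  case/andP: a0 => a0 api; apply/andP; split.
    by apply: divr_ge0 => //; rewrite mulr_ge0 ?ltW.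
  by rewrite ler_pdivrMr ?mulr_gt0//; lra.
have [y0|y0] := leP 0 y.
  exists (acos x / (2 * pi)); first by rewrite /= in_itv.
  rewrite /circle_param mulrC divfK; last by rewrite mulf_neq0 ?lt0r_neq0.
  by rewrite ax ay ger0_norm.
(* On the lower half circle the angle is [2 * pi - acos x]. *)
exists (1 - acos x / (2 * pi)); first by rewrite /= in_itv/=; lra.
rewrite /circle_param mulrBr mulr1 [_ * (_ / _)]mulrC divfK; last first.
  by rewrite mulf_neq0 ?lt0r_neq0.
rewrite cosB sinB mulr_natl cos2pi sin2pi ax ay ltr0_norm//.
by congr (_, _); ring.
Qed.

(** For [s < t], equal points give [cos (2 * pi * (t - s)) = 1], thus [sin (pi * (t - s)) = 0] by
    the double angle formula, which forces [t - s = 1]. *)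
Lemma circle_param_fiber s t : 0 <= s <= 1 -> 0 <= t <= 1 ->
  (circle_param s = circle_param t <-> same_fiber true s t).
Proof.
move=> s01 t01; split=> [st|[->//|[_ [][-> ->]]]]; rewrite ?circle_param01//.
wlog le : s t s01 t01 st / s < t => [wl|].
  have [/wl|/wl|] := ltgtP s t; [exact| |by left].
  move=> /(_ t01 s01 (esym st))[->|[_ [[-> ->]|[-> ->]]]].
  - by left.
  - by right; split=> //; right.
  - by right; split=> //; left.
have pi0 := pi_gt0 R.
have : cos (2 * pi * t - 2 * pi * s) = 1.
  case: st => cE sE; rewrite cosB -cE -sE -!expr2; exact: cos2Dsin2.
set d := 2 * pi * t - 2 * pi * s; have -> : d = (pi * (t - s)) *+ 2.
  by rewrite /d mulr2n; ring.
rewrite cos_mulr2n => c1.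
have : sin (pi * (t - s)) ^+ 2 = 0.
  by have := cos2Dsin2 (pi * (t - s)); move: c1; rewrite mulr2n; lra.
move=> /eqP; rewrite sqrf_eq0 => /eqP s0.
have [ts|] := ltP (t - s) 1; last by right; split=> //; left; lra.
have : 0 < sin (pi * (t - s)) by apply: sin_gt0_pi; apply/andP; split; nra.
by rewrite s0 ltxx.
Qed.

(* Borsuk-Ulam: u takes the same value at two antipodal points. *)
Lemma no_circle_injection (u : R * R -> R) :
  {within circle R, continuous u} ->
  {in circle R &, injective u} -> False.
Proof.
move=> uc ui; pose v t := u (circle_param t).
have vc : continuous v.
  apply/continuous_subspace_setT.
  apply: (@Defs.within_continuous_comp _ _ _ setT (circle R) circle_param u) uc.
    by move=> t _; exact: circle_param_in.
  exact/continuous_subspaceT/circle_param_continuous.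
(* As [v 0 = v 1], the difference takes opposite values at 0 and 1/2. *)
have [|||t] := @IVT R (fun t => v t - v (t + 2^-1)) 0 2^-1 0.
- by rewrite invr_ge0.
- apply: continuous_subspaceT => t; apply: cvgB; first exact: vc.
  apply: (@continuous_comp _ _ _ (fun t : R => t + 2^-1) v); last exact: vc.
  by apply: cvgD; [exact: cvg_id|exact: cvg_cst].
- have -> : 2^-1 + 2^-1 = 1 :> R by lra.
  rewrite add0r /v -circle_param01 -/(v 0) ge_min le_max.
  by case: (leP (v 0) (v 2^-1)) => [?|/ltW ?];
    rewrite ?subr_le0 ?subr_ge0; apply/andP; split; apply/orP; tauto.
rewrite in_itv/= => t01 /eqP; rewrite subr_eq0 => /eqP /ui.
rewrite !inE => /(_ (circle_param_in _) (circle_param_in _)).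
by move=> /circle_param_fiber[]; lra.
Qed.
End Circle.

(** * Matching two cobordisms *)

Section CircleComponents.
Variables (R : realType) (M : oriented_manifold R).

(** Relates the topological definition of a circle component to parameters: a loop has the fibres of
    [circle_param], and a segment cannot be a circle by [no_circle_injection]. *)
Lemma circle_componentsP (C : set M) : circle_components M C <->
  exists2 g : R -> M, component_param true g & C = g @` `[0, 1].
Proof.
split=> [[[x Cx] [f [h [fK hK fc hc]]]]|[g gP ->]].
  have [loop [g [gP xg]]] := component_param_ex x.
  have Cg : C = g @` `[0, 1] by rewrite Cx.
  case: loop gP => [gP|gP]; first by exists g.
  (* A parameter that is not a loop is injective; its inverse [phi] would send the circle
     injectively into the line. *)
  have [|phi phiK] := @segment_factor R M R g id.
    by move=> s t s01 t01 /(param_fiber gP s01 t01)[|[]].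
  case: (@no_circle_injection R (phi \o h)).
    apply: (@Defs.within_continuous_comp _ _ _ (circle R) C h phi) => //.
      by move=> z /hK[].
    rewrite Cg; apply: (@segment_factor_continuous R M R _ g id phi) => //.
      exact: carrier_hausdorff.
      by case: gP => -[].
    by move=> t; exact: cvg_id.
  move=> z z'; rewrite !inE => zc zc' /= phi_hz.
  have [+ <-] := hK _ zc; have [+ <-] := hK _ zc'; rewrite Cg.
  move=> [t' t01' gt'] [t t01 gt].
  have {}t01 : 0 <= t <= 1 by move: t01; rewrite /= in_itv.
  have {}t01' : 0 <= t' <= 1 by move: t01'; rewrite /= in_itv.
  by move: phi_hz; rewrite -gt -gt' !phiK// => ->.
have [gi gf _] := gP; split.
  by exists (g 0); rewrite (param_component gP)//; lra.
rewrite -circle_param_surj; apply: homeomorphic_images.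
- exact: carrier_hausdorff.
- exact: norm_hausdorff.
- exact: gi.1.
- exact: circle_param_continuous.
- move=> s t s01 t01; apply: (iff_trans (gf _ _ s01 t01)).
  by apply: iff_sym; exact: circle_param_fiber.
Qed.

(** Components are open by [param_open], so compactness leaves finitely many. Thus [nb_circles] is a
    true count. *)
Lemma finite_circle_components : finite_set (circle_components M).
Proof.
have [|s sP] := compact_nbhs_cover (V := connected_component [set: M])
    (@carrier_compact _ M).
  move=> x; apply: open_nbhs_nbhs; split; last exact: connected_component_refl.
  by have [loop [g [gP ->]]] := component_param_ex x; exact: param_open gP.
have fin : finite_set [set connected_component [set: M] x | x in [set` s]].
  exact/finite_image/finite_seq.
apply: sub_finite_set fin => _ [[x ->] _]; have [y ys yx] := sP x.
by exists y => //; exact: same_connected_component.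
Qed.
End CircleComponents.

(** * The map matching two families of parameters *)

Section GlueParams.
Variables (R : realType) (M N : oriented_manifold R).

Lemma increasing_at_orientation (f : M -> N) : continuous f ->
    (forall x, exists c d, [/\ atlas M c, atlas N d, chart_dom c x,
      chart_dom d (f x) & increasing_at c d f x]) ->
  orientation_preserving f.
Proof.
move=> fc h c d Mc Nd x cx dfx; have [c' [d' [Mc' Nd' cx' dfx' inc]]] := h x.
have cc' := atlas_oriented Mc Mc' cx cx'.
have dd' := atlas_oriented Nd' Nd dfx' dfx.
have := increasing_at_comp (fc x) inc dd'; apply: increasing_at_comp cc'.
by move=> ?; exact: cvg_id.
Qed.

Variables (loop : bool) (g : R -> M) (h : R -> N) (f : M -> N).
Hypotheses (gP : component_param loop g) (hP : component_param loop h).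
Hypothesis fg : forall t, 0 <= t <= 1 -> f (g t) = h t.
Let gi : immersed g 0 1. Proof. by case: gP. Qed.
Let hi : immersed h 0 1. Proof. by case: hP. Qed.

Lemma factor_continuous_at t : 0 <= t <= 1 -> {for g t, continuous f}.
Proof.
move=> t01.
have /subspace_continuousP fc : {within g @` `[0, 1], continuous f}.
  by apply: segment_factor_continuous hi.1 fg => //;
    [exact: carrier_hausdorff|exact: gi.1].
have gt : (g @` `[0, 1]) (g t) by exists t => //=; rewrite in_itv.
have := fc _ gt; rewrite within_interior//.
by have := param_open gP => /interior_id ->.
Qed.

(** On either side of [g t], nearby points are of the form [g u] with images [h u], and both
    coordinates increase with [u]. The two sides are joined by [ltr_glue]. *)
Lemma factor_increasing_at c d t : 0 <= t <= 1 -> atlas M c -> atlas N d ->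
  chart_dom c (g t) -> chart_dom d (h t) -> increasing_at c d f (g t).
Proof.
move=> t01 Mc Nd cgt dht.
have [V Vt right] : exists2 V, nbhs (g t) V & forall y z, V y -> V z ->
    c (g t) <= c y -> c (g t) <= c z -> (c y < c z) = (d (f y) < d (f z)).
  case: (param_right gP t01) => [m|[t' t01' gt']].
    exists (fun y => chart_dom c y /\ c y <= c (g t)).
      exact: filterS2 (chart_dom_nbhs cgt) (boundary_minus_near m Mc cgt).
    move=> y z [cy yt] [cz zt] ty tz.
    have -> : y = g t by apply: (chart_inj cy cgt); apply/le_anti/andP.
    have -> : z = g t by apply: (chart_inj cz cgt); apply/le_anti/andP.
    by rewrite !ltxx.
  (* The time [t'] may be the other end of a loop; [h] agrees there because it factors through
     [g]. *)
  have ht' : h t' = h t by rewrite -!fg ?gt'//; lra.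
  rewrite -gt' -ht' in cgt dht *.
  have [|V Vt Vc] := gi.2 c t' Mc _ cgt; first lra.
  have [|W Wt Wd] := hi.2 d t' Nd _ dht; first lra.
  have VWt : nbhs t' (V `&` W) by exact: filterI.
  have VW := immersed_cover_right gi t01' Mc cgt VWt.
  eexists; first exact: VW.
  move=> y z Py Pz /Py[u [[Vu Wu] tu <-]] /Pz[v [[Vv Wv] tv <-]].
  have u01 : 0 <= u <= 1 by lra.
  have v01 : 0 <= v <= 1 by lra.
  by rewrite (fg u01) (fg v01) -(Wd u v)// -(Vc u v).
have [W Wt left] : exists2 W, nbhs (g t) W & forall y z, W y -> W z ->
    c y <= c (g t) -> c z <= c (g t) -> (c y < c z) = (d (f y) < d (f z)).
  case: (param_left gP t01) => [m|[t' t01' gt']].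
    exists (fun y => chart_dom c y /\ c (g t) <= c y).
      exact: filterS2 (chart_dom_nbhs cgt) (boundary_plus_near m Mc cgt).
    move=> y z [cy yt] [cz zt] ty tz.
    have -> : y = g t by apply: (chart_inj cy cgt); apply/le_anti/andP.
    have -> : z = g t by apply: (chart_inj cz cgt); apply/le_anti/andP.
    by rewrite !ltxx.
  have ht' : h t' = h t by rewrite -!fg ?gt'//; lra.
  rewrite -gt' -ht' in cgt dht *.
  have [|V' Vt' Vc] := gi.2 c t' Mc _ cgt; first lra.
  have [|W Wt Wd] := hi.2 d t' Nd _ dht; first lra.
  have VWt : nbhs t' (V' `&` W) by exact: filterI.
  have VW := immersed_cover_left gi t01' Mc cgt VWt.
  eexists; first exact: VW.
  move=> y z Py Pz /Py[u [[Vu Wu] tu <-]] /Pz[v [[Vv Wv] tv <-]].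
  have u01 : 0 <= u <= 1 by lra.
  have v01 : 0 <= v <= 1 by lra.
  by rewrite (fg u01) (fg v01) -(Wd u v)// -(Vc u v).
exists (V `&` W); first exact: filterI.
apply: (@ltr_glue R M (g t) _ c (d \o f)).
- by split; exact: nbhs_singleton.
- by move=> y z [Vy _] [Vz _]; exact: right.
- by move=> y z [_ Wy] [_ Wz]; exact: left.
Qed.
End GlueParams.

Lemma glue_component_params (R : realType) (M N : oriented_manifold R)
    (I : Type) (loop : I -> bool) (g : I -> R -> M) (h : I -> R -> N) :
    (forall i, component_param (loop i) (g i)) ->
    (forall i, component_param (loop i) (h i)) ->
    (forall x, exists i, exists2 t, 0 <= t <= 1 & g i t = x) ->
    (forall i j s t, 0 <= s <= 1 -> 0 <= t <= 1 -> g i s = g j t -> i = j) ->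
  exists f : M -> N, [/\ continuous f, orientation_preserving f &
    forall i t, 0 <= t <= 1 -> f (g i t) = h i t].
Proof.
move=> gP hP cover sep.
have [x|f fP] := @choice M N (fun x y =>
    exists i, exists2 t, 0 <= t <= 1 & g i t = x /\ h i t = y).
  by have [i [t t01 gt]] := cover x; exists (h i t), i, t.
have fg i t : 0 <= t <= 1 -> f (g i t) = h i t.
  move=> t01; have [j [s s01 [gs <-]]] := fP (g i t).
  have ji := sep _ _ _ _ s01 t01 gs; subst j.
  (* Both parameters have the fibres [same_fiber (loop i)], so the value chosen by [f] does not
     depend on the time. *)
  exact/(param_fiber (hP i) s01 t01)/(param_fiber (gP i) s01 t01).
have fc : continuous f.
  move=> x; have [i [t t01 <-]] := cover x.
  exact: (factor_continuous_at (gP i) (hP i) (fg i)).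
exists f; split=> //; apply: increasing_at_orientation => // x.
have [i [t t01 <-]] := cover x.
have [c Mc cgt] := atlas_cover (g i t); have [d Nd dht] := atlas_cover (h i t).
exists c, d; split=> //; first by rewrite fg.
exact: (factor_increasing_at (gP i) (hP i) (fg i)).
Qed.

(** * Labelled boundary points and the matching of cobordisms *)

Section CobordismPoints.
Variables (R : realType) (X Y : ob1Cob).
Implicit Types (K : cobordism R X Y) (u v : 'I_(ob_size X) + 'I_(ob_size Y)).

(** It depends on the objects only, so corresponding points of two cobordisms have the same sign. *)
Definition point_sign u : sign :=
  match u with inl i => ob_sign i | inr j => opp_sign (ob_sign j) end.

Lemma cob_point_sign K u : boundary_point (point_sign u) (cob_point K u).
Proof. by case: u => i; [exact: cob_in_sign|exact: cob_out_sign]. Qed.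

Lemma cob_point_inj K : injective (cob_point K).
Proof.
have no i j : cob_in K i <> cob_out K j.
  move=> ij; have : (range (cob_in K) `&` range (cob_out K)) (cob_in K i).
    by split; [exists i|exists j].
  by rewrite cob_disjoint.
move=> [i|i] [j|j] /=.
- by move=> /cob_in_inj ->.
- by move=> /no.
- by move=> /esym/no.
- by move=> /cob_out_inj ->.
Qed.

Lemma boundary_cob_point K s x : boundary_point s x ->
  exists2 u, cob_point K u = x & point_sign u = s.
Proof.
move=> sx; have [u ux] : exists u, cob_point K u = x.
  have : boundary K x by exists s.
  rewrite -cob_boundary => -[[i _ <-]|[j _ <-]]; first by exists (inl i).
  by exists (inr j).
exists u => //; have := cob_point_sign K u; rewrite ux => us.
case: s sx us => sx; case: (point_sign u) => // us.
- by case: (boundary_plus_not_minus sx).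
- by case: (boundary_plus_not_minus us).
Qed.

(** An initial point can only be at time 0 of a parameter that is not a loop; segments can thus be
    indexed by their initial points. *)
Lemma interval_param_ex K u : point_sign u = plus -> exists g, exists2 v,
  component_param false g &
  [/\ g 0 = cob_point K u, g 1 = cob_point K v & point_sign v = minus].
Proof.
move=> u_plus; have := cob_point_sign K u; rewrite u_plus => Ku.
have [loop [g [gP Kug]]] := component_param_ex (cob_point K u).
have [t t01 gt] : exists2 t, 0 <= t <= 1 & g t = cob_point K u.
  have : connected_component [set: K] (cob_point K u) (cob_point K u).
    exact: connected_component_refl.
  by rewrite Kug => -[t t01 gt]; exists t => //; move: t01; rewrite /= in_itv.
have [nl t0] : ~~ loop /\ t = 0 by apply: (param_plus gP t01); rewrite gt.
have [_ _ /(_ nl)[_ /boundary_cob_point[v gv v_minus]]] := gP.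
by exists g, v; [case: (loop) nl gP|split; rewrite // -t0].
Qed.

Section Cover.
Variables (K : cobordism R X Y) (J : Type) (D : J -> set K).
Hypotheses (D_inj : injective D)
  (D_circles : forall C, circle_components K C <-> exists j, D j = C).
Variable g : {u | point_sign u = plus} + J -> R -> K.
Hypotheses
  (gP : forall i, component_param (if i is inl _ then false else true) (g i))
  (g_plus : forall e, g (inl e) 0 = cob_point K (sval e))
  (g_circle : forall j, g (inr j) @` `[0, 1] = D j).

(** A component of circle type is listed by [D], and any other one by its initial point. *)
Lemma cob_params_cover x : exists i, exists2 t, 0 <= t <= 1 & g i t = x.
Proof.
suff [i [t t01 gt]] : exists i, (g i @` `[0, 1]) x.
  by exists i, t => //; move: t01; rewrite /= in_itv.
have [loop [h [hP xh]]] := component_param_ex x.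
have hx : (h @` `[0, 1]) x by rewrite -xh; exact: connected_component_refl.
case: loop hP => hP.
  have /D_circles[j jh] : circle_components K (h @` `[0, 1]).
    by apply/circle_componentsP; exists h.
  by exists (inr j); rewrite g_circle jh.
have [_ _ [//|/boundary_cob_point[u hu u_plus] _]] := hP.
exists (inl (exist _ u u_plus)).
rewrite -(param_component (gP (inl (exist _ u u_plus))) (t := 0)) ?g_plus /=;
  last first.
  by rewrite lexx ler01.
rewrite hu (param_component hP)//; lra.
Qed.

(** Parameters that meet have the same component as image. A segment contains its initial point and
    no other one, a loop contains none, and loops are told apart by [D_inj]. *)
Lemma cob_params_separated i j s t :
  0 <= s <= 1 -> 0 <= t <= 1 -> g i s = g j t -> i = j.
Proof.
move=> s01 t01 gst.
have ij : g i @` `[0, 1] = g j @` `[0, 1].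
  by rewrite -(param_component (gP i) s01) gst (param_component (gP j) t01).
have plus_end e i' : g (inl e) @` `[0, 1] = g i' @` `[0, 1] ->
    exists e', i' = inl e' /\ cob_point K (sval e) = cob_point K (sval e').
  move=> E; have [r r01 gr] : (g i' @` `[0, 1]) (cob_point K (sval e)).
    by rewrite -E; exists 0; rewrite ?g_plus //= in_itv/= lexx ler01.
  have {}r01 : 0 <= r <= 1 by move: r01; rewrite /= in_itv.
  have := cob_point_sign K (sval e); rewrite (svalP e) -gr.
  move=> /(param_plus (gP i') r01)[]; case: i' gr {E} => // e' gr _ r0.
  by exists e'; split=> //; rewrite r0 g_plus.
case: i ij {gst} => [[u u_plus] /plus_end[[v v_plus] [->]]|i].
  by move=> /cob_point_inj /= uv; congr inl; exact: eq_exist.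
case: j => [e /esym/plus_end[e' []]//|j].
by rewrite !g_circle => /D_inj ->.
Qed.
End Cover.

(** Segments are matched by their initial points, circles by any bijection between two finite sets
    of equal cardinality. *)
Lemma cob_equiv_of_invariants (K L : cobordism R X Y) :
    (forall u v, same_component K u v -> same_component L u v) ->
    nb_circles K = nb_circles L ->
  cob_equiv K L.
Proof.
move=> KL nb.
have /card_set_bijP[beta [beta_im beta_inj beta_surj]] :
    (circle_components K #= circle_components L)%card.
  apply/(fcard_eq (finite_circle_components K) (finite_circle_components L)).
  exact: nb.
pose J := {C | circle_components K C}.
pose I := ({u | point_sign u = plus} + J)%type.
pose loop (i : I) := if i is inl _ then false else true.
have pair (i : I) : exists gh : (R -> K) * (R -> L),
    [/\ component_param (loop i) gh.1, component_param (loop i) gh.2 &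
    match i with
    | inl u => [/\ gh.1 0 = cob_point K (sval u), gh.2 0 = cob_point L (sval u) &
        exists2 v, gh.1 1 = cob_point K v & gh.2 1 = cob_point L v]
    | inr C => gh.1 @` `[0, 1] = sval C /\ gh.2 @` `[0, 1] = beta (sval C)
    end].
  case: i => [[u u_plus]|[C KC]] /=; last first.
    have /circle_componentsP[g gP Cg] := KC.
    have /circle_componentsP[h hP Ch] := beta_im _ KC.
    by exists (g, h).
  have [g [v gP [g0 g1 v_minus]]] := interval_param_ex K u_plus.
  have [h [w hP [h0 h1 _]]] := interval_param_ex L u_plus.
  exists (g, h); split=> //; split=> //; exists v => //.
  (* The terminal point [v] of the segment of [K] lies in the component of [u] in [L], where the
     only terminal point is [h 1]. *)
  have /KL : same_component K u v.
    rewrite /same_component -g0 -g1 (param_component gP); last by lra.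
    by exists 1 => //=; rewrite in_itv/= ler01 lexx.
  rewrite /same_component -h0 (param_component hP); last by lra.
  move=> [t t01 ht]; have {}t01 : 0 <= t <= 1 by move: t01; rewrite /= in_itv.
  have := cob_point_sign L v; rewrite v_minus -ht.
  by move=> /(param_minus hP t01)[_ t1]; rewrite -t1.
have [gh ghP] := choice pair.
pose g i := (gh i).1; pose h i := (gh i).2.
have gP i : component_param (loop i) (g i) by case: (ghP i).
have hP i : component_param (loop i) (h i) by case: (ghP i).
have g0 e : g (inl e) 0 = cob_point K (sval e) by case: (ghP (inl e)) => _ _ [].
have h0 e : h (inl e) 0 = cob_point L (sval e) by case: (ghP (inl e)) => _ _ [].
have gJ (j : J) : g (inr j) @` `[0, 1] = sval j by case: (ghP (inr j)) => _ _ [].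
have hJ (j : J) : h (inr j) @` `[0, 1] = beta (sval j).
  by case: (ghP (inr j)) => _ _ [].
have K_circles C : circle_components K C <-> exists j : J, sval j = C.
  by split=> [KC|[j <-]]; [exists (exist _ C KC)|exact: svalP].
have L_circles C : circle_components L C <-> exists j : J, beta (sval j) = C.
  split=> [/beta_surj[C' KC' <-]|[j <-]]; first by exists (exist _ C' KC').
  exact/beta_im/svalP.
have K_inj : injective (sval : J -> set K).
  by move=> [C KC] [C' KC'] /= CC'; exact: eq_exist.
have L_inj : injective (beta \o sval : J -> set L).
  move=> j j' /= jj'; apply: K_inj; apply: beta_inj jj';
    exact/mem_set/svalP.
have [f [fc fo fg]] := glue_component_params gP hP
  (cob_params_cover K_circles gP g0 gJ) (cob_params_separated K_inj gP g0 gJ).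
(* Exchanging the two families gives the inverse of [f]. *)
have [f' [fc' _ fh]] := glue_component_params hP gP
  (cob_params_cover L_circles hP h0 hJ) (cob_params_separated L_inj hP h0 hJ).
have fpoint u : f (cob_point K u) = cob_point L u.
  case u_sign : (point_sign u).
    pose i := exist (fun u => point_sign u = plus) u u_sign.
    by have := fg (inl i) 0; rewrite g0 h0; apply; lra.
  (* A terminal point is at time 1 of some segment, whose ends in [K] and [L] carry the same
     label. *)
  have [i [t t01 gt]] := cob_params_cover K_circles gP g0 gJ (cob_point K u).
  have := cob_point_sign K u; rewrite u_sign -gt.
  move=> /(param_minus (gP i) t01)[]; case: i gt => // i gt _ t1; subst t.
  have [_ _ [_ _ [v gv hv]]] := ghP (inl i).
  move: gt; rewrite fg// /h hv /g gv => /cob_point_inj -> //.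
exists f, f'; split=> //.
- split=> [x _|y _||]; try exact: continuous_subspaceT.
  + split=> //; have [i [t t01 <-]] := cob_params_cover K_circles gP g0 gJ x.
    by rewrite fg// fh.
  + split=> //; have [i [t t01 <-]] := cob_params_cover L_circles hP h0 hJ y.
    by rewrite fh// fg.
- by move=> i; exact: (fpoint (inl i)).
- by move=> j; exact: (fpoint (inr j)).
Qed.

End CobordismPoints.

Theorem proposition3p2 (R : realType) (F : fieldType)
    (charF0 : [pchar F]%R =i pred0) (p : nat) (p_ge2 : (2 <= p)%N)
    (X Y : ob1Cob) (K L : hom1Cob R X Y) :
  brauer F p K = brauer F p L -> K = L.
Proof.
(* By definition [brauer] is the matrix of the chosen representative, so [KL] applies to
   representatives as it stands. *)
move=> KL; rewrite -(cob_reprK K) -(cob_reprK L); apply/cob_classP.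
apply: cob_equiv_of_invariants.
  by move=> u v; exact: (brauer_cob_same_component charF0 p_ge2 KL).
exact: (brauer_cob_nb_circles charF0 p_ge2 KL).
Qed.
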